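(* Let $k\ge 2$ and $r\ge k$ be integers and let $H$ be a complete $k$-partite graph. Then $H$ is weakly $K_{r+1}$-Turán-stable. That is: for every $\varepsilon>0$ there exist $\delta>0$ and $n_0$ such that for every $n\ge n_0$, if $G$ is an $n$-vertex $K_{r+1}$-free graph with $\mathcal N(H,G)\ge \mathrm{ex}(n,H,K_{r+1})-\delta n^{h}$, where $h=|V(H)|$, then there is a complete $r$-partite graph $T$ on $n$ vertices whose edit distance from $G$ is at most $\varepsilon n^2$.
   Context: For graphs $H$ and $G$, $\mathcal N(H,G)$ denotes the number of subgraphs of $G$ isomorphic to $H$. For graphs $H,F$, $\mathrm{ex}(n,H,F)$ is the maximum of $\mathcal N(H,G)$ over all $n$-vertex graphs $G$ containing no subgraph isomorphic to $F$ ($F$-free). The edit distance of two $n$-vertex graphs $G$ and $G'$ is the minimum number of edges that must be deleted from and added to $G$ to obtain a graph isomorphic to $G'$. Given a graph $F$ with chromatic number $r+1$ and a graph $H$ with chromatic number at most $r$ and $h=|V(H)|$ vertices, $H$ is called weakly $F$-Turán-stable if for every $\varepsilon>0$ there exists $\delta>0$ such that (for all sufficiently large $n$) every $n$-vertex $F$-free graph $G$ with $\mathcal N(H,G)\ge \mathrm{ex}(n,H,F)-\delta n^h$ has edit distance at most $\varepsilon n^2$ from some complete $r$-partite $n$-vertex graph. *)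

(* Defs.v *)
From HB Require Import structures.
From mathcomp Require Import all_boot all_order all_algebra.
From mathcomp Require Import fingroup perm.
From mathcomp Require Import reals.
Set Implicit Arguments. Unset Strict Implicit. Unset Printing Implicit Defensive.
Import Order.TTheory GRing.Theory Num.Theory.

Definition is_graph n (E : {set {set 'I_n}}) : bool :=
  [forall e in E, #|e| == 2].

(* Complete multipartite graph with vertex-to-part map g : 'I_n -> 'I_m:
   x ~ y iff g x != g y (parts may be empty). *)
Definition cmp_graph n m (g : 'I_n -> 'I_m) : {set {set 'I_n}} :=
  [set [set x; y] | x in 'I_n, y in 'I_n & g x != g y].

Definition Kgraph m : {set {set 'I_m}} :=
  [set [set x; y] | x in 'I_m, y in 'I_m & x != y].

Definition is_complete_kpartite h k (H : {set {set 'I_h}}) : Prop :=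
  exists g : 'I_h -> 'I_k, (forall i : 'I_k, exists x, g x = i) /\ H = cmp_graph g.

Definition Ncopies h n (H : {set {set 'I_h}}) (G : {set {set 'I_n}}) : nat :=
  #|[set p : {set 'I_n} * {set {set 'I_n}} |
      [exists phi : {ffun 'I_h -> 'I_n},
         [&& injectiveb phi, p.1 == phi @: 'I_h
           & p.2 == [set phi @: (e : {set 'I_h}) | e in H]]] && (p.2 \subset G)]|.

Definition Ffree f n (F : {set {set 'I_f}}) (G : {set {set 'I_n}}) : bool :=
  Ncopies F G == 0.

Definition ex_gen n h f (H : {set {set 'I_h}}) (F : {set {set 'I_f}}) : nat :=
  \max_(G : {set {set 'I_n}} | is_graph G && Ffree F G) Ncopies H G.

Definition relabel n (s : {perm 'I_n}) (E : {set {set 'I_n}}) : {set {set 'I_n}} :=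
  [set s @: (e : {set 'I_n}) | e in E].

Definition edit_dist n (G G' : {set {set 'I_n}}) : nat :=
  \big[minn/#|(G :\: G') :|: (G' :\: G)|]_(s : {perm 'I_n})
     #|(G :\: relabel s G') :|: (relabel s G' :\: G)|.

(* Main.v *)
Require Import Defs.
From HB Require Import structures.
From mathcomp Require Import all_boot all_order all_algebra.
From mathcomp Require Import fingroup perm.
From mathcomp Require Import reals.
From mathcomp Require Import ring lra zify.
Set Implicit Arguments. Unset Strict Implicit. Unset Printing Implicit Defensive.
Import Order.TTheory GRing.Theory Num.Theory.
Local Open Scope ring_scope.

(** Write [t(G, x)] for the weighted number of homomorphisms [H -> G], where the
    vertices of [G] carry weights [x].  Blow-ups of a [K_{r+1}]-free graph are
    [K_{r+1}]-free, so averaging over random blow-ups bounds [t(G, x)] by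
    [Lam (sum x)^h], where [Lam] is the normalised extremal number, and the
    hypothesis says that the uniform weights nearly attain this bound.

    Second variation: for each vertex [v] move a proportion [e] of the weight of
    every vertex that is not heavily joined to [v] onto [v].  Summed over [v] the
    first order terms cancel by symmetry.  In the second order terms, a pair of
    vertices of [H] from the same part contributes a sum of squares, and a pair from
    different parts contributes the weight of the copies that use an edge between two
    such vertices.  Hence there are few triples [v, a, b] with [va], [vb] light and [ab]
    heavy: being joined by a light pair is almost transitive, and the heavy graph is
    close to a complete multipartite graph, with at most [r] parts since [G] is
    [K_{r+1}]-free.

    Finally there are few light edges: otherwise one of them, [uw], lies inside a
    large part [P] and joins two typical vertices, and concentrating the weight of
    [P] on [u] and [w] splits [P] into two parts, which creates many new copies. *)

(** Homomorphisms to [G], not necessarily injective, of the complete multipartite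
    graph with vertex-to-part map [g]. *)
Definition khom h k (g : 'I_h -> 'I_k) (V : Type) (G : rel V) (phi : 'I_h -> V) : bool :=
  [forall i, forall j, (g i != g j) ==> G (phi i) (phi j)].

Lemma khomP h k (g : 'I_h -> 'I_k) (V : Type) (G : rel V) (phi : 'I_h -> V) :
  reflect (forall i j, g i != g j -> G (phi i) (phi j)) (khom g G phi).
Proof.
apply: (iffP forallP) => [H i j gij | H i].
  by have /forallP/(_ j)/implyP := H i; apply.
by apply/forallP => j; apply/implyP; apply: H.
Qed.

Lemma eq_khom h k (g : 'I_h -> 'I_k) (V : Type) (G : rel V) (phi psi : 'I_h -> V) :
  phi =1 psi -> khom g G phi = khom g G psi.
Proof. by move=> e; apply/khomP/khomP => H i j gij; [rewrite -!e | rewrite !e]; apply: H. Qed.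

(** * Averaging over one coordinate *)

Section Update.
Variables (R : realFieldType) (I V : finType).

Definition upd (phi : {ffun I -> V}) i a : {ffun I -> V} :=
  [ffun l => if l == i then a else phi l].

(** Swapping [a] with the value [phi i] is an involution on the pairs [(phi, a)]. *)
Lemma sum_upd (F : {ffun I -> V} -> R) i :
  \sum_phi \sum_a F (upd phi i a) = #|V|%:R * \sum_phi F phi.
Proof.
rewrite pair_big /=.
pose swap (p : {ffun I -> V} * V) := (upd p.1 i p.2, p.1 i).
have swapK : involutive swap.
  move=> [phi a]; rewrite /swap /=; congr (_, _); last by rewrite ffunE eqxx.
  by apply/ffunP => l; rewrite !ffunE; case: eqP => [->|].
rewrite (reindex_inj (inv_inj swapK)) /=.
rewrite -(pair_bigA _ (fun (p : {ffun I -> V}) (a : V) => F (upd (upd p i a) i (p i)))) /=.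
transitivity (\sum_(p : {ffun I -> V}) \sum_(a : V) F p).
  apply: eq_bigr => p _; apply: eq_bigr => a _; congr F.
  by apply/ffunP => l; rewrite !ffunE; case: eqP => [->|].
by rewrite mulr_sumr; apply: eq_bigr => p _; rewrite sumr_const mulr_natl.
Qed.

(** Two distinct coordinates of a uniformly random map are independent and uniform. *)
Lemma sum_pair_coord (f : V -> V -> R) (i j : I) : i != j ->
  (\sum_(phi : {ffun I -> V}) f (phi i) (phi j)) * #|V|%:R ^+ 2 =
  (\sum_a \sum_b f a b) * #|V|%:R ^+ #|I|.
Proof.
move=> ij.
rewrite expr2 mulrA [X in X * _]mulrC -(sum_upd _ i) (eq_bigr (fun phi : {ffun I -> V} =>
  \sum_a f a (phi j))); last first.
  by move=> phi _; apply: eq_bigr => a _; rewrite !ffunE eqxx eq_sym (negPf ij).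
rewrite mulrC -(sum_upd _ j) (eq_bigr (fun=> \sum_a \sum_b f a b)); last first.
  move=> phi _; rewrite exchange_big /=; apply: eq_bigr => a _.
  by apply: eq_bigr => b _; rewrite !ffunE eqxx.
by rewrite sumr_const card_ffun -[_ *+ _]mulr_natr natrX.
Qed.

End Update.

(** * Second order expansion of a product *)

Section Expansion.
Variable R : realFieldType.
Implicit Types (s : seq R) (e : R).

(** The induction step of the expansions below: a new factor [1 + e * z] adds to the remainder [x]
    of some order [e * z] times the remainder [y] of the order below. *)
Lemma expansion_step e (z x y B : R) : 0 <= e -> `|x| <= e * B -> `|y| <= B ->
  `|x + e * z * y| <= e * ((1 + `|z|) * B).
Proof.
move=> e0 xB yB; apply: le_trans (ler_normD _ _) _.
rewrite !normrM (ger0_norm e0).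
have z0 := normr_ge0 z; have : `|z| * `|y| <= `|z| * B by rewrite ler_wpM2l.
nra.
Qed.

Lemma prod_expand0 s e : 0 <= e <= 1 ->
  `|\prod_(z <- s) (1 + e * z)| <= \prod_(z <- s) (1 + `|z|).
Proof.
move=> /andP[e0 e1]; rewrite normr_prod; apply: ler_prod => z _.
rewrite normr_ge0 /=; apply: le_trans (ler_normD _ _) _.
rewrite normr1 lerD2l normrM (ger0_norm e0).
by rewrite ler_piMl.
Qed.

Lemma prod_expand1 s e : 0 <= e <= 1 ->
  `|\prod_(z <- s) (1 + e * z) - 1| <= e * \prod_(z <- s) (1 + `|z|).
Proof.
move=> e01; have /andP[e0 _] := e01.
elim: s => [|z s IH]; first by rewrite !big_nil subrr normr0 mulr1.
rewrite !big_cons mulrDl mul1r addrAC; apply: expansion_step => //.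
exact: prod_expand0.
Qed.

Lemma prod_expand2 s e : 0 <= e <= 1 ->
  `|\prod_(z <- s) (1 + e * z) - 1 - e * \sum_(z <- s) z|
  <= e * (e * \prod_(z <- s) (1 + `|z|)).
Proof.
move=> e01; have /andP[e0 _] := e01.
elim: s => [|z s IH]; first by rewrite !big_nil subrr mulr0 subrr normr0 !mulr_ge0.
rewrite !big_cons; set P := \prod_(_ <- _) _ in IH *; set Q := \prod_(_ <- _) _ in IH *.
rewrite [e * ((1 + _) * _)]mulrCA.
have -> : (1 + e * z) * P - 1 - e * (z + \sum_(z <- s) z) =
  (P - 1 - e * \sum_(z <- s) z) + e * z * (P - 1) by ring.
by apply: expansion_step => //; apply: prod_expand1.
Qed.

Lemma prod_expand3 s e : 0 <= e <= 1 ->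
  `|\prod_(z <- s) (1 + e * z) - 1 - e * \sum_(z <- s) z
    - e ^+ 2 / 2 * ((\sum_(z <- s) z) ^+ 2 - \sum_(z <- s) z ^+ 2)|
  <= e * (e * (e * \prod_(z <- s) (1 + `|z|))).
Proof.
move=> e01; have /andP[e0 _] := e01.
elim: s => [|z s IH].
  by rewrite !big_nil subrr mulr0 expr0n subrr mulr0 !subrr normr0 !mulr_ge0.
rewrite !big_cons; set P := \prod_(_ <- _) _ in IH *; set Q := \prod_(_ <- _) _ in IH *.
rewrite [e * ((1 + _) * _)]mulrCA [e * ((1 + _) * _)]mulrCA.
set A := \sum_(_ <- _) _ in IH *; set B := \sum_(_ <- _) _ in IH *.
have -> : (1 + e * z) * P - 1 - e * (z + A) - e ^+ 2 / 2 * ((z + A) ^+ 2 - (z ^+ 2 + B)) =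
  (P - 1 - e * A - e ^+ 2 / 2 * (A ^+ 2 - B)) + e * z * (P - 1 - e * A) by field.
by apply: expansion_step => //; apply: prod_expand2.
Qed.

Lemma prod_second_order (I : finType) (z : I -> R) e : 0 <= e <= 1 ->
  1 + e * (\sum_i z i) + e ^+ 2 / 2 * (\sum_i \sum_(j | j != i) z i * z j)
  - e ^+ 3 * \prod_i (1 + `|z i|) <= \prod_i (1 + e * z i).
Proof.
move=> e01; have := prod_expand3 [seq z i | i <- index_enum I] e01.
rewrite !big_map; set P := \prod_i (1 + e * _); set Q := \prod_i _.
have -> : \sum_i \sum_(j | j != i) z i * z j = (\sum_i z i) ^+ 2 - \sum_i z i ^+ 2.
  rewrite [(_) ^+ 2]expr2 big_distrlr /= -sumrB; apply: eq_bigr => i _.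
  by rewrite [in RHS](bigD1 i) //= expr2 addrC addrK.
by rewrite ler_norml => /andP[+ _]; set A := \sum_i _; set B := _ ^+ 2 - _; lra.
Qed.

End Expansion.

(** * Second variation of the homomorphism count *)

Definition nkhom (R : realFieldType) h k (g : 'I_h -> 'I_k) (V : finType) (G : rel V) : R :=
  \sum_(phi : {ffun 'I_h -> V}) (khom g G phi)%:R.

Definition khom_bound (R : realFieldType) h k (g : 'I_h -> 'I_k) (V : finType) (G : rel V)
    (Lam : R) :=
  forall x : V -> R, (forall a, 0 <= x a) ->
  \sum_(phi : {ffun 'I_h -> V}) (khom g G phi)%:R * \prod_i x (phi i)
  <= Lam * (\sum_a x a) ^+ h.

(** The second partial derivative, at unit weights, of the weighted count in the weights of [a] and
    [b], restricted to pairs of vertices of [H] in different classes. *)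
Definition edge_weight (R : realFieldType) h k (g : 'I_h -> 'I_k) (V : finType) (G : rel V)
    (a b : V) : R :=
  \sum_(phi : {ffun 'I_h -> V}) (khom g G phi)%:R *
    \sum_i \sum_(j | g i != g j) ((phi i == a) && (phi j == b))%:R.

Section Variation.
Variables (R : realFieldType) (h k : nat) (g : 'I_h -> 'I_k) (V : finType) (G : rel V).
Hypothesis Gsym : symmetric G.

Notation N := (#|V|%:R : R).
Notation C := (edge_weight R g G).

Lemma sum_eq1 (F : V -> R) (v : V) : \sum_a (a == v)%:R * F a = F v.
Proof.
rewrite (bigD1 v) //= eqxx mul1r big1 ?addr0 // => a /negPf ->.
by rewrite mul0r.
Qed.

Lemma sum_delta (v : V) : \sum_a (a == v)%:R = 1 :> R.
Proof. by rewrite -[RHS](sum_eq1 (fun=> 1) v); apply: eq_bigr => a _; rewrite mulr1. Qed.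

Lemma sum_cst (x : R) : \sum_(v : V) x = N * x.
Proof. by rewrite sumr_const mulr_natl. Qed.

Lemma edge_weightC a b : C a b = C b a.
Proof.
apply: eq_bigr => phi _; congr (_ * _); rewrite (exchange_big_dep predT) //=.
apply: eq_bigr => j _; apply: eq_big => [i|i _]; first by rewrite eq_sym.
by rewrite andbC.
Qed.

Lemma edge_weight_ge0 a b : 0 <= C a b.
Proof.
apply: sumr_ge0 => phi _; apply: mulr_ge0 => //.
by apply: sumr_ge0 => i _; apply: sumr_ge0.
Qed.

Lemma edge_weight_edge a b : 0 < C a b -> G a b.
Proof.
apply: contraTT => nG; rewrite -leNgt /edge_weight big1 // => phi _.
have [/khomP H|] := boolP (khom g G phi); last by rewrite mul0r.
rewrite mul1r big1 // => i _; rewrite big1 // => j gij.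
by case: eqP => //= ea; case: eqP => //= eb; move: nG; rewrite -ea -eb H.
Qed.

Lemma sum_edge_weight (F : V -> V -> R) :
  \sum_(phi : {ffun 'I_h -> V}) (khom g G phi)%:R *
    (\sum_i \sum_(j | g i != g j) F (phi i) (phi j)) =
  \sum_a \sum_b F a b * C a b.
Proof.
pose X (phi : {ffun 'I_h -> V}) a b : R := 
  \sum_i \sum_(j | g i != g j) ((phi i == a) && (phi j == b))%:R.
transitivity (\sum_(phi : {ffun 'I_h -> V}) (khom g G phi)%:R * \sum_a \sum_b F a b * X phi a b).
  apply: eq_bigr => phi _; congr (_ * _).
  under [RHS]eq_bigr => a _.
    under eq_bigr => b _.
      rewrite /X mulr_sumr; under eq_bigr do rewrite mulr_sumr.
      over.
    rewrite exchange_big /=; under eq_bigr do rewrite exchange_big /=.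
    over.
  rewrite exchange_big /=; apply: eq_bigr => i _.
  rewrite exchange_big /=; apply: eq_bigr => j _.
  rewrite -(sum_eq1 (fun a => F a (phi j))); apply: eq_bigr => a _.
  rewrite -(sum_eq1 (F a)) mulr_sumr; apply: eq_bigr => b _.
  by rewrite -mulnb natrM eq_sym [phi j == _]eq_sym; ring.
under eq_bigr do rewrite mulr_sumr; rewrite exchange_big /=; apply: eq_bigr => a _.
under eq_bigr do rewrite mulr_sumr; rewrite exchange_big /=; apply: eq_bigr => b _.
by rewrite mulr_sumr; apply: eq_bigr => phi _; rewrite mulrCA.
Qed.

(** Once [phi] is fixed outside [i] and [j], the constraints on [phi i] and [phi j] are
    identical and independent, so that the sum over these two values is a square. *)
Lemma same_part_ge0 (y : V -> R) i j : i != j -> g i = g j ->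
  0 <= \sum_(phi : {ffun 'I_h -> V}) (khom g G phi)%:R * (y (phi i) * y (phi j)).
Proof.
move=> ij gij; pose F (phi : {ffun 'I_h -> V}) : R := (khom g G phi)%:R * (y (phi i) * y (phi j)).
rewrite -[leRHS]/(\sum_phi F phi).
have [V0|V0] := posnP #|V|.
  rewrite big1 // => phi _; have := max_card (pred1 (phi i)).
  by rewrite card1 V0.
have N0 : 0 < N by rewrite ltr0n.
rewrite -(pmulr_rge0 _ N0) -(sum_upd _ j).
rewrite -(pmulr_rge0 _ N0) -(sum_upd _ i).
apply: sumr_ge0 => phi _.
(* [ad a] collects the constraints on a value at [i], or equally at [j]; [rest] collects those
   avoiding both. *)
pose ad a := [forall l, (g l != g i) ==> G a (phi l)].
pose rest := [forall l, forall m, [&& l != i, l != j, m != i, m != j & g l != g m]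
   ==> G (phi l) (phi m)].
have E a b : khom g G (upd (upd phi i a) j b) = [&& rest, ad a & ad b].
  apply/khomP/and3P => [H | [/forallP Hr /forallP Ha /forallP Hb] l m glm].
    split.
    - apply/forallP => l; apply/forallP => m; apply/implyP => /and5P[li lj mi mj glm].
      by have := H l m glm; rewrite !ffunE !(negPf li, negPf lj, negPf mi, negPf mj).
    - apply/forallP => l; apply/implyP => gl; have := H i l.
      rewrite !ffunE eqxx (negPf ij) eq_sym => /(_ gl).
      have -> : l == j = false by apply: contraNF gl => /eqP ->; rewrite gij.
      by have -> : l == i = false by apply: contraNF gl => /eqP ->.
    - apply/forallP => l; apply/implyP => gl; have := H j l.
      rewrite !ffunE eqxx -gij eq_sym => /(_ gl).
      have -> : l == j = false by apply: contraNF gl => /eqP ->; rewrite gij.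
      by have -> : l == i = false by apply: contraNF gl => /eqP ->.
  rewrite !ffunE.
  have [lj|lj] := eqVneq l j.
    have gm : g m != g i by rewrite eq_sym gij -lj.
    have -> : m == j = false by apply: contraNF gm => /eqP ->; rewrite gij.
    have -> : m == i = false by apply: contraNF gm => /eqP ->.
    by have /implyP := Hb m; apply.
  have [li|li] := eqVneq l i.
    have gm : g m != g i by rewrite eq_sym -li.
    have -> : m == j = false by apply: contraNF gm => /eqP ->; rewrite gij.
    have -> : m == i = false by apply: contraNF gm => /eqP ->.
    by have /implyP := Ha m; apply.
  have [mj|mj] := eqVneq m j.
    by rewrite Gsym; have /implyP := Hb l; apply; rewrite gij -mj.
  have [mi|mi] := eqVneq m i.
    by rewrite Gsym; have /implyP := Ha l; apply; rewrite -mi.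
  by have /forallP/(_ m)/implyP := Hr l; apply; rewrite li lj mi mj.
have -> : \sum_a \sum_b F (upd (upd phi i a) j b) = rest%:R * (\sum_a (ad a)%:R * y a) ^+ 2.
  rewrite expr2 big_distrlr /= mulr_sumr; apply: eq_bigr => a _.
  rewrite mulr_sumr; apply: eq_bigr => b _.
  rewrite /F E !ffunE !eqxx (negPf ij) -!mulnb !natrM; ring.
by rewrite mulr_ge0 // sqr_ge0.
Qed.

(** The bound is tested on the weights [1 + e * y], which are nonnegative and again sum to [N]. The
    product is expanded to second order, pairs from the same part are dropped by [same_part_ge0],
    and the cubic error is bounded by summing over all maps. *)
Lemma variation (Lam e : R) (y : V -> R) : khom_bound g G Lam -> 0 <= e <= 1 ->
  (forall a, -1 <= y a) -> \sum_a y a = 0 -> \sum_a `|y a| <= 2 * N ->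
  nkhom R g G
  + e * \sum_(phi : {ffun 'I_h -> V}) (khom g G phi)%:R * \sum_i y (phi i)
  + e ^+ 2 / 2 * (\sum_a \sum_b y a * y b * C a b)
  - e ^+ 3 * (3 * N) ^+ h <= Lam * N ^+ h.
Proof.
move=> bd e01 y1 y0 yN; have /andP[e0 e1] := e01.
have sumE : \sum_a (1 + e * y a) = N.
  by rewrite big_split /= -mulr_sumr y0 mulr0 addr0 sumr_const.
rewrite -[in leRHS]sumE; apply: le_trans (bd _ _); last by move=> a; have := y1 a; nra.
apply: (@le_trans _ _ (\sum_(phi : {ffun 'I_h -> V}) (khom g G phi)%:R *
  (1 + e * (\sum_i y (phi i)) + e ^+ 2 / 2 * (\sum_i \sum_(j | j != i) y (phi i) * y (phi j))
  - e ^+ 3 * \prod_i (1 + `|y (phi i)|)))); last first.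
  by apply: ler_sum => phi _; rewrite ler_wpM2l // prod_second_order.
under [leRHS]eq_bigr do rewrite mulrBr !mulrDr mulr1 ![(khom _ _ _)%:R * (_ * _)]mulrCA.
rewrite sumrB !big_split /= -!mulr_sumr lerB ?lerD //.
- rewrite ler_wpM2l //; first by rewrite mulr_ge0 ?sqr_ge0 // invr_ge0.
  rewrite -(sum_edge_weight (fun a b => y a * y b)).
  under eq_bigr do rewrite mulr_sumr; rewrite exchange_big /=.
  under [leRHS]eq_bigr do rewrite mulr_sumr; rewrite [leRHS]exchange_big /=.
  apply: ler_sum => i _.
  under eq_bigr do rewrite mulr_sumr; rewrite exchange_big /=.
  under [leRHS]eq_bigr do rewrite mulr_sumr; rewrite [leRHS]exchange_big /=.
  rewrite [leRHS](bigID (fun j => g i != g j)) /=.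
  rewrite -[leLHS]addr0; apply: lerD; last first.
    apply: sumr_ge0 => j /andP[ji /negPn/eqP gij].
    by apply: same_part_ge0; rewrite // eq_sym.
  rewrite le_eqVlt; apply/orP; left; apply/eqP; apply: eq_bigl => j.
  by case: (eqVneq j i) => [->|]; rewrite ?eqxx.
- rewrite ler_wpM2l ?exprn_ge0 //.
  apply: (@le_trans _ _ (\sum_(phi : {ffun 'I_h -> V}) \prod_i (1 + `|y (phi i)|))).
    apply: ler_sum => phi _; rewrite ler_piMl //; first by apply: prodr_ge0 => i _; rewrite addr_ge0.
    by case: (khom _ _ _).
  rewrite -(bigA_distr_bigA (fun=> fun a => 1 + `|y a|)) prodr_const card_ord.
  rewrite lerXn2r ?nnegrE ?mulr_ge0 //; first by apply: sumr_ge0 => a _; rewrite addr_ge0.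
  by rewrite big_split /= sumr_const; move: yN; lra.
Qed.

End Variation.

(** * Triples with two light pairs and one heavy pair *)

Section Triples.
Variables (R : realType) (h k : nat) (g : 'I_h -> 'I_k) (V : finType) (G : rel V).
Hypothesis Gsym : symmetric G.

Notation N := (#|V|%:R : R).
Notation C := (edge_weight R g G).

(** [C a b >= c N^(h - 2)], free of truncated subtraction. *)
Definition heavy (c : R) (a b : V) : bool := c * N ^+ h <= C a b * N ^+ 2.

Lemma heavyC c : symmetric (heavy c).
Proof. by move=> a b; rewrite /heavy edge_weightC. Qed.

Lemma heavy_edge c a b : 0 < c -> heavy c a b -> G a b.
Proof.
move=> c0 hv; apply: (@edge_weight_edge R _ _ g).
have N0 : 0 < N by rewrite ltr0n; apply/card_gt0P; exists a.
have : 0 < C a b * N ^+ 2 by apply: lt_le_trans hv; rewrite mulr_gt0 ?exprn_gt0.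
by rewrite pmulr_lgt0 ?exprn_gt0.
Qed.

Lemma heavyW c c' a b : c' <= c -> heavy c a b -> heavy c' a b.
Proof. by move=> cc; apply: le_trans; rewrite ler_wpM2r ?exprn_ge0. Qed.

(** The first variation disappears since the perturbations
    [y v = \sum_(a | L v a) (delta_v - delta_a)] satisfy [\sum_v y v = 0]. *)
Lemma light_variation (L : rel V) (Lam e : R) : symmetric L ->
  khom_bound g G Lam -> 0 <= e <= 1 ->
  e ^+ 2 / 2 * (\sum_v \sum_a \sum_b (L v a)%:R * (L v b)%:R * C a b
    - 2 * \sum_v (\sum_a (L v a)%:R) * (\sum_b (L v b)%:R * C v b))
  <= N * (Lam * N ^+ h - nkhom R g G + e ^+ 3 * (3 * N) ^+ h).
Proof.
move=> Lsym bd e01.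
pose s v : R := \sum_a (L v a)%:R.
pose y v a : R := s v * (a == v)%:R - (L v a)%:R.
have s0 v : 0 <= s v by apply: sumr_ge0.
have sN v : s v <= N.
  rewrite -[N]sumr_const; apply: ler_sum => a _; by case: (L v a).
have V1 v : nkhom R g G
    + e * \sum_(phi : {ffun 'I_h -> V}) (khom g G phi)%:R * \sum_i y v (phi i)
    + e ^+ 2 / 2 * (\sum_a \sum_b y v a * y v b * C a b)
    - e ^+ 3 * (3 * N) ^+ h <= Lam * N ^+ h.
  apply: variation => //.
  - by move=> a; rewrite /y; have := s0 v; case: (a == v); case: (L v a) => /=; lra.
  - by rewrite sumrB -mulr_sumr sum_delta mulr1 subrr.
  - apply: (@le_trans _ _ (\sum_a (s v * (a == v)%:R + (L v a)%:R))).
      apply: ler_sum => a _; apply: le_trans (ler_normB _ _) _.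
      by rewrite !ger0_norm ?mulr_ge0.
    rewrite big_split /= -mulr_sumr sum_delta -/(s v).
    by have := sN v; lra.
have := @ler_sum _ _ (index_enum V) predT _ _ (fun v _ => V1 v).
rewrite sumrB !big_split /= !sum_cst -!mulr_sumr.
have -> : \sum_v \sum_(phi : {ffun 'I_h -> V}) (khom g G phi)%:R * \sum_i y v (phi i) = 0.
  rewrite exchange_big big1 //= => phi _; rewrite -mulr_sumr exchange_big big1 ?mulr0 //= => i _.
  rewrite sumrB; apply/eqP; rewrite subr_eq0; apply/eqP.
  under eq_bigr do rewrite mulrC eq_sym; rewrite (sum_eq1 s).
  by apply: eq_bigr => v _; rewrite Lsym.
have : \sum_v \sum_a \sum_b (L v a)%:R * (L v b)%:R * C a b
    - 2 * \sum_v (\sum_a (L v a)%:R) * (\sum_b (L v b)%:R * C v b) <=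
   \sum_v \sum_a \sum_b y v a * y v b * C a b.
  rewrite mulr_sumr -sumrB; apply: ler_sum => v _; rewrite -/(s v).
  have -> : \sum_a \sum_b y v a * y v b * C a b = s v ^+ 2 * C v v
     - 2 * (s v * \sum_b (L v b)%:R * C v b)
     + \sum_a \sum_b (L v a)%:R * (L v b)%:R * C a b.
    have E a : \sum_b y v a * y v b * C a b =
       (a == v)%:R * (s v ^+ 2 * C a v - s v * \sum_b (L v b)%:R * C a b)
       - s v * ((L v a)%:R * C a v) + \sum_b (L v a)%:R * (L v b)%:R * C a b.
      rewrite -(sum_eq1 (fun b => C a b) v) !mulr_sumr -!sumrB mulr_sumr -sumrB -big_split.
      by apply: eq_bigr => b _; rewrite /y /=; ring.
    under eq_bigr do rewrite E.
    rewrite big_split sumrB /= sum_eq1 -mulr_sumr.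
    by under [X in _ - s v * X + _]eq_bigr do rewrite edge_weightC; ring.
  have := edge_weight_ge0 R g G v v; have := sqr_ge0 (s v); nra.
set A := _ - 2 * _; set B := \sum_v _; set K := nkhom _ _ _.
move: (e ^+ 3 * _) => Z AB.
have e2 : 0 <= e ^+ 2 / 2 by rewrite mulr_ge0 ?sqr_ge0 // invr_ge0.
by have := ler_wpM2l e2 AB; rewrite -/N; lra.
Qed.

(** In [light_variation], with [L] the light pairs, the negative term involves only pairs of weight
    below [c N^(h-2)], whereas each counted triple contributes at least [c' N^(h-2)] to the positive
    one. Dividing by [e^2/2] gives the errors in [d] and [e]. *)
Lemma light_heavy_triples (Lam e c c' d : R) : (0 < #|V|)%N -> 0 <= c -> khom_bound g G Lam ->
  0 < e <= 1 -> (Lam - d) * N ^+ h <= nkhom R g G ->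
  c' * (\sum_v \sum_a \sum_b [&& ~~ heavy c v a, ~~ heavy c v b & heavy c' a b]%:R)
  <= N ^+ 3 * (2 * c + 2 * d / e ^+ 2 + 2 * e * 3 ^+ h).
Proof.
move=> V0 c0 bd /andP[e0 e1] near; set T := \sum_v _.
have N0 : 0 < N by rewrite ltr0n.
have Lsym : symmetric (fun a b => ~~ heavy c a b) by move=> a b; rewrite heavyC.
have e01 : 0 <= e <= 1 by rewrite ltW.
have := light_variation Lsym bd e01.
set A := \sum_v \sum_a _; set B := \sum_v _; set K := nkhom _ _ _ in near *.
have BN : B * N ^+ 2 <= c * N ^+ h * N ^+ 3.
  have -> : c * N ^+ h * N ^+ 3 = \sum_(v : V) \sum_(a : V) \sum_(b : V) c * N ^+ h.
    by rewrite !sum_cst; ring.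
  rewrite mulr_suml; apply: ler_sum => v _; rewrite !mulr_suml; apply: ler_sum => a _.
  rewrite -mulrA mulr_suml mulr_sumr; apply: ler_sum => b _.
  have cN : 0 <= c * N ^+ h by rewrite mulr_ge0 ?exprn_ge0.
  have C0 := edge_weight_ge0 R g G v b.
  rewrite -mulrA; case: (~~ heavy c v a); rewrite ?mul0r ?mul1r //.
  have [hv|] := boolP (heavy c v b); first by rewrite mul0r.
  by rewrite mul1r -ltNge => /ltW.
have AT : c' * N ^+ h * T <= A * N ^+ 2.
  rewrite mulr_sumr mulr_suml; apply: ler_sum => v _; rewrite mulr_sumr mulr_suml.
  apply: ler_sum => a _; rewrite mulr_sumr mulr_suml; apply: ler_sum => b _.
  have C0 := edge_weight_ge0 R g G a b.
  case: (heavy c v a); case: (heavy c v b); rewrite /= ?mulr0 ?mul0r ?mul1r //.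
  have [hab|_] := boolP (heavy c' a b); first by rewrite mulr1.
  by rewrite mulr0 mulr_ge0 ?sqr_ge0.
rewrite -/N; set X := N ^+ h in near AT BN *; rewrite exprMn -/X.
have X0 : 0 < X by rewrite exprn_gt0.
have e20 : 0 < e ^+ 2 by rewrite exprn_gt0.
move=> H; have {}H : A <= 2 * B + 2 * N * X * (d / e ^+ 2 + e * 3 ^+ h).
  have : A - 2 * B <= 2 / e ^+ 2 * (N * (d * X + e ^+ 3 * (3 ^+ h * X))).
    rewrite -(ler_pM2l (_ : 0 < e ^+ 2 / 2)); last by rewrite divr_gt0.
    apply: le_trans H _.
    have -> : e ^+ 2 / 2 * (2 / e ^+ 2 * (N * (d * X + e ^+ 3 * (3 ^+ h * X)))) =
       N * (d * X + e ^+ 3 * (3 ^+ h * X)) by field; rewrite gt_eqF.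
    by rewrite ler_pM2l //; move: near; lra.
  have -> : 2 / e ^+ 2 * (N * (d * X + e ^+ 3 * (3 ^+ h * X))) =
     2 * N * X * (d / e ^+ 2 + e * 3 ^+ h) by field; rewrite gt_eqF.
  lra.
rewrite -(ler_pM2l X0).
have : A * N ^+ 2 <= (2 * B + 2 * N * X * (d / e ^+ 2 + e * 3 ^+ h)) * N ^+ 2.
  by rewrite ler_wpM2r ?sqr_ge0.
set D := d / e ^+ 2.
have -> : 2 * d / e ^+ 2 = 2 * D by rewrite mulrA.
move: AT BN; move: (3 ^+ h) => Y; lra.
Qed.

End Triples.

(** [light_heavy_triples] needs two thresholds [c < c'] far apart.  Among the geometric
    scales [K ^ i], the pigeonhole principle gives two consecutive ones with few pairs
    in between. *)
Lemma few_bad_triples (R : realType) (h : nat) (eta : R) : 0 < eta ->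
  exists2 d : R, 0 < d &
  forall (k : nat) (g : 'I_h -> 'I_k) (V : finType) (G : rel V) (Lam : R),
  symmetric G -> khom_bound g G Lam -> (Lam - d) * #|V|%:R ^+ h <= nkhom R g G ->
  exists2 c : R, 0 < c <= eta &
    \sum_v \sum_a \sum_b [&& ~~ heavy g G c v a, ~~ heavy g G c v b & heavy g G c a b]%:R
    <= eta * #|V|%:R ^+ 3.
Proof.
(* [K] is the ratio of consecutive scales; the factor 12 gives [6 * K <= eta / 2], half of the final
   budget. *)
move=> eta0; pose K := Num.min eta 1 / 12.
have K0 : 0 < K by rewrite divr_gt0 // lt_min eta0 ltr01.
have K1 : K <= 1 / 12 by rewrite ler_pM2r ?invr_gt0 // ge_min lexx orbT.
have Keta : 12 * K <= eta by rewrite /K mulrC divfK ?pnatr_eq0 ?ge_min ?lexx.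
(* The number of heavy pairs grows with the scale index but stays below [N ^+ 2], so among more than
   [2 / eta] steps one adds at most [eta / 2 * N ^+ 2] pairs. *)
pose M := (Num.bound (2 / eta)).
have M0 : 2 / eta < M%:R by apply: archi_boundP; rewrite divr_ge0 // ltW.
pose c i : R := K ^+ i.+1.
have c0 i : 0 < c i by rewrite exprn_gt0.
have cle i j : (i <= j)%N -> c j <= c i.
  move=> ij; apply: ler_wiXn2l => //; first exact: ltW.
  by lra.
have Y0 : 1 <= 3 ^+ h :> R by apply: exprn_ege1; lra.
have Yp : 0 < 3 ^+ h :> R := lt_le_trans ltr01 Y0.
(* With these choices [2 * d / e ^+ 2] and [2 * e * 3 ^+ h] both equal [2 * K * c M], which is at
   most [2 * K * c i] for every scale in use. *)
pose e := K * c M / 3 ^+ h; pose d := e ^+ 2 * (K * c M).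
have e0 : 0 < e by rewrite /e divr_gt0 // mulr_gt0.
have cM1 : c M <= 1 by apply: exprn_ile1; [exact: ltW | lra].
have e1 : e <= 1.
  rewrite ler_pdivrMr ?mul1r //.
  by apply: le_trans Y0; have := c0 M; nra.
have eY : e * 3 ^+ h = K * c M by rewrite /e divfK // gt_eqF.
exists d; first by rewrite /d mulr_gt0 ?exprn_gt0 // mulr_gt0.
move=> k g V G Lam Gsym bd near.
have [V0|V0] := posnP #|V|.
  exists eta; first by rewrite eta0 lexx.
  rewrite V0 expr0n mulr0 big1 // => v _.
  by have := max_card (pred1 v); rewrite card1 V0.
have N0 : 0 < #|V|%:R :> R by rewrite ltr0n.
set N := #|V|%:R in near N0 *.
pose W i : R := \sum_a \sum_b (heavy g G (c i) a b)%:R.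
have WN i : W i <= N ^+ 2.
  have -> : N ^+ 2 = \sum_(a : V) \sum_(b : V) 1 by rewrite !sum_cst expr2 mulr1.
  by apply: ler_sum => a _; apply: ler_sum => b _; case: (heavy _ _ _ _ _).
have [i iM Wi] : exists2 i, (i < M)%N & W i.+1 - W i <= eta / 2 * N ^+ 2.
  case: (boolP [exists i : 'I_M, W i.+1 - W i <= eta / 2 * N ^+ 2]) => [/existsP[i Hi]|].
    by exists i.
  rewrite negb_exists => /forallP H.
  have Wm m : (m <= M)%N -> m%:R * (eta / 2 * N ^+ 2) <= W m.
    elim: m => [|m IH] mM.
      by rewrite mul0r; apply: sumr_ge0 => a _; apply: sumr_ge0.
    have := IH (ltnW mM); have := H (Ordinal mM); rewrite /= -ltNge -natr1; lra.
  have := le_trans (Wm M (leqnn _)) (WN M).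
  rewrite mulrA ger_pMl ?exprn_gt0 //.
  by move: M0; rewrite ltr_pdivrMr // => M0 M1; exfalso; lra.
exists (c i.+1).
  rewrite c0 /=; apply: le_trans (_ : K <= _); last lra.
  rewrite -[leRHS]mulr1 /c exprS ler_pM2l //.
  by apply: exprn_ile1; [exact: ltW | lra].
have := @light_heavy_triples R h k g V G Gsym Lam e (c i.+1) (c i) d V0 (ltW (c0 _)) bd
  _ near.
rewrite e0 e1 => /(_ isT); rewrite -/N; set T := \sum_v _ => HT.
have {}HT : T <= 6 * K * N ^+ 3.
  rewrite -(ler_pM2l (c0 i)); apply: le_trans HT _.
  have -> : 2 * d / e ^+ 2 = 2 * (K * c M) by rewrite /d; field; rewrite gt_eqF.
  rewrite -[2 * e * _]mulrA eY.
  have -> : c i.+1 = K * c i by rewrite /c [in LHS]exprS.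
  have N3 : 0 < N ^+ 3 by rewrite exprn_gt0.
  have : K * c M <= K * c i by rewrite ler_pM2l // cle // ltnW.
  by nra.
(* Lowering the threshold for [ab] from [c i] to [c i.+1] adds at most [W i.+1 - W i] pairs for each
   [v]. *)
have : \sum_v \sum_a \sum_b [&& ~~ heavy g G (c i.+1) v a, ~~ heavy g G (c i.+1) v b &
   heavy g G (c i.+1) a b]%:R <= T + N * (W i.+1 - W i).
  rewrite -sum_cst -big_split; apply: ler_sum => v _ /=.
  rewrite -sumrB -big_split; apply: ler_sum => a _ /=.
  rewrite -sumrB -big_split; apply: ler_sum => b _ /=.
  have hh : heavy g G (c i) a b -> heavy g G (c i.+1) a b.
    by apply: heavyW; apply: cle.
  case: (heavy g G (c i) a b) hh => [-> //|_].
    by rewrite subrr addr0.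
  by rewrite !andbF add0r subr0 andbA; case: (~~ _ && ~~ _); case: (heavy _ _ _ _ _).
have : N * (W i.+1 - W i) <= eta / 2 * N ^+ 3.
  by rewrite exprS mulrCA ler_pM2l.
have N3 : 0 < N ^+ 3 by rewrite exprn_gt0.
have : 6 * K * N ^+ 3 <= eta / 2 * N ^+ 3 by rewrite ler_pM2r //; lra.
lra.
Qed.

(** * Approximate structure *)

(** For irreflexive [E], pairwise adjacent values are automatically distinct, so this says that [E]
    contains no [K_{r+1}]. *)
Definition clique_free r (V : finType) (E : rel V) :=
  forall phi : 'I_r.+1 -> V, ~~ [forall i, forall j, (i != j) ==> E (phi i) (phi j)].

Lemma clique_freeW r (V : finType) (E F : rel V) :
  subrel E F -> clique_free r F -> clique_free r E.
Proof.
move=> sEF cF phi; apply: contra (cF phi) => /forallP H.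
apply/forallP => i; apply/forallP => j; apply/implyP => ij; apply: sEF.
by have /forallP/(_ j)/implyP := H i; apply.
Qed.

Lemma clique_free_card r (V : finType) (E : rel V) (K : {set V}) : clique_free r E ->
  (forall x y, x \in K -> y \in K -> x != y -> E x y) -> (#|K| <= r)%N.
Proof.
move=> cf clK; rewrite leqNgt; apply/negP => rK.
have /card_gt0P[x0 _] : (0 < #|K|)%N by apply: leq_ltn_trans rK.
have /negP := cf (fun i => nth x0 (enum K) i); apply.
have ltK (i : 'I_r.+1) : (i < size (enum K))%N by rewrite -cardE (leq_trans (ltn_ord i)).
apply/forallP => i; apply/forallP => j; apply/implyP => ij; apply: clK.
- by rewrite -mem_enum mem_nth.
- by rewrite -mem_enum mem_nth.
- by rewrite nth_uniq ?enum_uniq.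
Qed.

Section Structure.
Variables (R : realType) (V : finType) (E : rel V) (r : nat) (t : R).
Hypotheses (Esym : symmetric E) (Eirr : irreflexive E).
Hypothesis Ecf : clique_free r.+1 E.
Notation N := (#|V|%:R : R).

Let bad v a b := [&& ~~ E v a, ~~ E v b & E a b].

(** The parts are read off a maximal clique [K] of vertices lying in few bad triples: a
    vertex goes to the part of the first element of [K] that it is not joined to. *)
Lemma near_multipartite : 0 < t ->
  \sum_v \sum_a \sum_b (bad v a b)%:R <= t ^+ 2 * N ^+ 3 ->
  exists T : V -> 'I_r.+1,
    \sum_a \sum_b (E a b != (T a != T b))%:R <= (3 * r.+1%:R + 4) * t * N ^+ 2.
Proof.
move=> t0 few.
have [V0|V0] := posnP #|V|.
  exists (fun=> ord0); rewrite V0 expr0n mulr0 big1 // => v _.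
  by have := max_card (pred1 v); rewrite card1 V0.
have N0 : 0 < N by rewrite ltr0n.
pose d1 z : R := \sum_a \sum_b (bad z a b)%:R.
pose d2 z : R := \sum_a \sum_b (bad a z b)%:R.
(* [z] is the first or the second vertex of many bad triples; the third place is symmetric to the
   second. *)
pose B z := (t * N ^+ 2 < d1 z) || (t * N ^+ 2 < d2 z).
have d10 z : 0 <= d1 z by apply: sumr_ge0 => a _; apply: sumr_ge0.
have d20 z : 0 <= d2 z by apply: sumr_ge0 => a _; apply: sumr_ge0.
have BN : \sum_z (B z)%:R <= 2 * t * N.
  have tN : 0 < t * N ^+ 2 by rewrite mulr_gt0 ?exprn_gt0.
  rewrite -(ler_pM2l tN) mulr_sumr.
  apply: (@le_trans _ _ (\sum_z (d1 z + d2 z))).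
    apply: ler_sum => z _; rewrite /B.
    case: (ltP _ (d1 z)) => [H|_] /=; first by rewrite mulr1 ler_wpDr // ltW.
    case: (ltP _ (d2 z)) => [H|_] /=; first by rewrite mulr1 ler_wpDl // ltW.
    by rewrite mulr0 addr_ge0.
  rewrite big_split /= [X in _ + X]exchange_big /=.
  by move: few; rewrite -/(\sum_v d1 v); set D := \sum_v _; lra.
pose P (K : {set V}) := [forall x in K, ~~ B x] &&
  [forall x in K, forall y in K, (x != y) ==> E x y].
have P0 : P set0.
  by apply/andP; split; apply/forallP => x; apply/implyP; rewrite inE.
have [K /maxsetP[/andP[/forall_inP KB /forall_inP KE] Kmax] _] := maxset_exists P0.
have Kr : (#|K| <= r.+1)%N.
  apply: clique_free_card Ecf _ => x y xK yK xy.
  by have /forall_inP/(_ _ yK)/implyP := KE _ xK; apply.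
(* By maximality, a vertex outside [B] adjacent to all of [K] could be added to [K]; members of [K]
   are not adjacent to themselves. *)
have hasN x : ~~ B x -> has (fun v => ~~ E x v) (enum K).
  move=> Bx; apply/negPn/negP => /hasPn H.
  have xE v : v \in K -> E x v by move=> vK; have := H v; rewrite mem_enum => /(_ vK)/negPn.
  have xK : x \notin K by apply/negP => /xE; rewrite Eirr.
  have /Kmax := subsetUr [set x] K; rewrite -/(x |: K) => eK.
  move: xK; rewrite -eK ?setU11 //.
  apply/andP; split.
    by apply/forall_inP => y /setU1P[->|/KB].
  apply/forall_inP => y yK; apply/forall_inP => z zK; apply/implyP => yz.
  case/setU1P: yK yz => [->|yK]; case/setU1P: zK => [->|zK]; rewrite ?eqxx // => yz.
  - exact: xE.
  - by rewrite Esym xE.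
  - by have /forall_inP/(_ _ zK)/implyP := KE _ yK; apply.
pose f x := find (fun v => ~~ E x v) (enum K).
have fK x : ~~ B x -> (f x < #|K|)%N by move=> /hasN; rewrite has_find -cardE.
(* Outside [B], [f x] is a position in [K], so [inord] keeps it; pairs meeting [B] are charged to
   [B]. *)
pose T x : 'I_r.+1 := inord (f x).
have TE x : ~~ B x -> T x = f x :> nat by move=> /fK fx; rewrite inordK // (leq_trans fx).
exists T.
have le1 a b (F : V -> R) v : (forall v, 0 <= F v) -> v \in K -> 1 <= F v ->
  1 <= (B a)%:R + (B b)%:R + \sum_(v in K) F v.
  move=> F0 vK Fv; rewrite (bigD1 v) //=.
  have : 0 <= \sum_(i in K | i != v) F i by apply: sumr_ge0.
  by case: (B a); case: (B b) => /=; lra.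
(* A pair on which [E] and [T] disagree either meets [B] or forms a bad triple with the element of
   [K] at the smaller of the positions [f a] and [f b]: adjacent vertices of one part both miss it,
   and of non-adjacent vertices of different parts exactly one does. *)
have pw a b : (E a b != (T a != T b))%:R <= (B a)%:R + (B b)%:R +
   \sum_(v in K) ((bad v a b)%:R + (bad a v b)%:R + (bad b v a)%:R) :> R.
  set F := fun v => (bad v a b)%:R + (bad a v b)%:R + (bad b v a)%:R : R.
  have F0 v : 0 <= F v by rewrite /F !addr_ge0.
  have S0 : 0 <= \sum_(v in K) F v by apply: sumr_ge0.
  have [Ba|Ba] := boolP (B a).
    by case: (_ != _); case: (B b) => /=; rewrite -/F; lra.
  have [Bb|Bb] := boolP (B b).
    by case: (_ != _) => /=; rewrite -/F; lra.
  have Ea := nth_find a (hasN _ Ba); have Eb := nth_find a (hasN _ Bb).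
  rewrite -/(f a) -/(f b) in Ea Eb.
  have inK x : ~~ B x -> nth a (enum K) (f x) \in K.
    by move=> /fK fx; rewrite -mem_enum mem_nth // -cardE.
  have := le1 a b F _ F0; rewrite (negPf Ba) (negPf Bb) => {}le1.
  have [Tab|Tab] := eqVneq (T a) (T b).
    have fab : f a = f b by rewrite -TE // Tab TE.
    have [Eab|] := boolP (E a b); last by rewrite !add0r.
    apply: (le1 _ (inK a Ba)); rewrite /F /bad Esym Ea Esym fab Eb Eab /=.
    by rewrite -addrA ler_wpDr ?addr_ge0.
  have [Eab|Eab] := boolP (E a b); first by rewrite !add0r.
  have := Tab; rewrite -val_eqE /= !TE //; case: (ltngtP (f a) (f b)) => // lt _.
    apply: (le1 _ (inK a Ba)); rewrite /F /bad Ea Eab /=.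
    by have := before_find a lt => /negbFE; rewrite Esym => ->; rewrite addrAC ler_wpDl ?addr_ge0.
  apply: (le1 _ (inK b Bb)); rewrite /F /bad Eb (Esym b a) Eab /=.
  by have := before_find a lt => /negbFE; rewrite Esym => ->; rewrite ler_wpDl ?addr_ge0.
apply: (@le_trans _ _ (\sum_a \sum_b ((B a)%:R + (B b)%:R +
   \sum_(v in K) ((bad v a b)%:R + (bad a v b)%:R + (bad b v a)%:R)))).
  by apply: ler_sum => a _; apply: ler_sum => b _; apply: pw.
under eq_bigr do rewrite !big_split /= sum_cst.
rewrite !big_split /= -mulr_sumr sum_cst.
under [X in _ + X]eq_bigr do rewrite exchange_big.
rewrite exchange_big /=.
have : \sum_(v in K) \sum_a \sum_b ((bad v a b)%:R + (bad a v b)%:R + (bad b v a)%:R)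
   <= \sum_(v in K) 3 * (t * N ^+ 2).
  apply: ler_sum => v /KB; rewrite /B negb_or -!leNgt => /andP[H1 H2].
  under eq_bigr do rewrite !big_split /=.
  rewrite !big_split /= -/(d1 v) -/(d2 v) [X in _ + X]exchange_big /= -/(d2 v).
  lra.
rewrite sumr_const -[_ *+ _]mulr_natr => H.
have : #|K|%:R <= r.+1%:R :> R by rewrite ler_nat.
have tN : 0 <= t * N ^+ 2 by rewrite mulr_ge0 ?sqr_ge0 // ltW.
move: BN H; set X := \sum_z _; set Y := \sum_(v in K) _ => BN H Kr'.
have : N * X <= N * (2 * t * N) by rewrite ler_pM2l.
have : 3 * (t * N ^+ 2) * #|K|%:R <= 3 * (t * N ^+ 2) * r.+1%:R by rewrite ler_wpM2l // mulr_ge0.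
move: (r.+1%:R) (#|K|%:R) H => rr kk; lra.
Qed.

End Structure.

(** * Counting homomorphisms to blow-ups *)

Section Pushforward.
Variables (R : realFieldType) (I V W : finType).

Lemma prod_natb (P : pred I) : \prod_i (P i)%:R = [forall i, P i]%:R :> R.
Proof.
have [/forallP H|] := boolP [forall i, P i]; first by rewrite big1 // => i _; rewrite H.
by rewrite negb_forall => /existsP[i /negPf Pi]; rewrite (bigD1 i) //= Pi mul0r.
Qed.

(** The maps [om] are grouped by their composite with [b]; the number of lifts of [phi] is the
    product of the fibre sizes over its values. *)
Lemma sum_pushforward (b : W -> V) (F : {ffun I -> V} -> R) :
  \sum_phi F phi * \prod_i (\sum_w (b w == phi i)%:R) =
  \sum_(om : {ffun I -> W}) F [ffun i => b (om i)].
Proof.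
transitivity (\sum_phi \sum_(om : {ffun I -> W}) ([ffun i => b (om i)] == phi)%:R * F phi).
  apply: eq_bigr => phi _; rewrite mulrC bigA_distr_bigA mulr_suml.
  apply: eq_bigr => om _; rewrite prod_natb; congr (_%:R * _).
  congr nat_of_bool; apply/forallP/eqP => [H|<- i]; last by rewrite ffunE.
  by apply/ffunP => i; rewrite ffunE; apply/eqP.
rewrite exchange_big; apply: eq_bigr => om _ /=.
by rewrite -[RHS](sum_eq1 F); apply: eq_bigr => phi _; rewrite eq_sym.
Qed.

Lemma ler_sum_inj (f : V -> W) (F : W -> R) : injective f -> (forall w, 0 <= F w) ->
  \sum_v F (f v) <= \sum_w F w.
Proof.
move=> injf F0; rewrite [leRHS](bigID (fun w => w \in f @: V)) /=.
rewrite big_imset /=; last by move=> x y _ _ /injf.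
by rewrite lerDl sumr_ge0.
Qed.

Definition mix (A : pred I) (phi zeta : {ffun I -> V}) : {ffun I -> V} :=
  [ffun i => if A i then zeta i else phi i].

(** Exchanging the values of [phi] and [zeta] on [A] is an involution on pairs of maps. *)
Lemma sum_mix (A : pred I) (F : {ffun I -> V} -> R) :
  \sum_phi \sum_zeta F (mix A phi zeta) = #|V|%:R ^+ #|I| * \sum_phi F phi.
Proof.
rewrite pair_bigA /=.
pose swap (p : {ffun I -> V} * {ffun I -> V}) := (mix A p.1 p.2, mix A p.2 p.1).
have swapK : involutive swap.
  move=> [phi zeta]; rewrite /swap /=.
  by congr (_, _); apply/ffunP => i; rewrite !ffunE; case: (A i).
rewrite (reindex_inj (inv_inj swapK)) /=.
transitivity (\sum_(p : {ffun I -> V} * {ffun I -> V}) F p.1).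
  apply: eq_bigr => p _; congr F.
  by apply/ffunP => i; rewrite !ffunE; case: (A i).
rewrite -(pair_bigA _ (fun p _ => F p)) /= mulr_sumr.
by apply: eq_bigr => p _; rewrite sumr_const card_ffun -natrX mulr_natl.
Qed.

End Pushforward.

Section Pairs.
Variables (R : realFieldType) (h k : nat) (g : 'I_h -> 'I_k).

(** Union bound over the pairs of distinct vertices of [H], each sent to a uniformly random pair. *)
Lemma sum_exists_pair (W : finType) (D : rel W) :
  (\sum_(om : {ffun 'I_h -> W}) [exists i, exists j, (g i != g j) && D (om i) (om j)]%:R)
    * #|W|%:R ^+ 2
  <= h%:R ^+ 2 * (\sum_a \sum_b (D a b)%:R) * #|W|%:R ^+ h :> R.
Proof.
apply: (@le_trans _ _ ((\sum_(om : {ffun 'I_h -> W})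
   \sum_i \sum_(j | j != i) (D (om i) (om j))%:R) * #|W|%:R ^+ 2)).
  rewrite ler_wpM2r ?sqr_ge0 //; apply: ler_sum => om _.
  have [/existsP[i /existsP[j /andP[gij Dij]]]|_] :=
    boolP [exists i, exists j, (g i != g j) && D (om i) (om j)]; last first.
    by apply: sumr_ge0 => i _; apply: sumr_ge0.
  have ji : j != i by apply: contraNneq gij => ->.
  rewrite (bigD1 i) //= (bigD1 j) //= Dij -addrA lerDl addr_ge0 ?sumr_ge0 // => l _.
  exact: sumr_ge0.
rewrite exchange_big /= mulr_suml.
set S := \sum_a \sum_b _.
have S0 : 0 <= S * #|W|%:R ^+ h.
  by rewrite mulr_ge0 ?exprn_ge0 // sumr_ge0 // => a _; apply: sumr_ge0.
apply: (@le_trans _ _ (\sum_(i < h) \sum_(j < h) S * #|W|%:R ^+ h)); last first.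
  by rewrite !sumr_const !card_ord -mulrnA -[leLHS]mulr_natl natrM expr2 -!mulrA.
apply: ler_sum => i _; rewrite exchange_big /= mulr_suml.
rewrite [leRHS](bigID (fun j => j != i)) /= -[leLHS]addr0; apply: lerD; last exact: sumr_ge0.
apply: ler_sum => j ji; rewrite (@sum_pair_coord R _ _ (fun a b => (D a b)%:R)) ?card_ord //.
by rewrite eq_sym.
Qed.

Lemma nkhom_diff (V : finType) (E F : rel V) : (0 < #|V|)%N ->
  nkhom R g E * #|V|%:R ^+ 2 <= nkhom R g F * #|V|%:R ^+ 2 +
   h%:R ^+ 2 * (\sum_a \sum_b (E a b != F a b)%:R) * #|V|%:R ^+ h.
Proof.
move=> V0; apply: le_trans (lerD (lexx _) (sum_exists_pair (fun a b => E a b != F a b))).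
rewrite -mulrDl ler_wpM2r ?sqr_ge0 // /nkhom -big_split; apply: ler_sum => phi _ /=.
have [/khomP H|_] := boolP (khom g E phi); last by rewrite addr_ge0.
have [_|nF] := boolP (khom g F phi); first by rewrite lerDl.
suff -> : [exists i, exists j, (g i != g j) && (E (phi i) (phi j) != F (phi i) (phi j))].
  by rewrite add0r.
move: nF; rewrite negb_forall => /existsP[i]; rewrite negb_forall => /existsP[j].
rewrite negb_imply => /andP[gij nF]; apply/existsP; exists i; apply/existsP; exists j.
by rewrite gij H //= (negPf nF).
Qed.

Lemma khom_bound_blowup (V W : finType) (G : rel V) (b : W -> V) (Lam : R) :
  khom_bound g G Lam ->
  \sum_(om : {ffun 'I_h -> W}) (khom g G (b \o om))%:R <= Lam * #|W|%:R ^+ h.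
Proof.
move=> /(_ (fun a => \sum_w (b w == a)%:R)) bd.
have -> : #|W|%:R = \sum_a \sum_w (b w == a)%:R :> R.
  rewrite exchange_big /= -[LHS]mulr1 -sum_cst; apply: eq_bigr => w _.
  by rewrite -[LHS](sum_delta R (b w)); apply: eq_bigr => a _; rewrite eq_sym.
apply: le_trans (bd _); last by move=> a; apply: sumr_ge0.
rewrite (sum_pushforward b (fun phi => (khom g G phi)%:R)).
apply: ler_sum => om _; rewrite ler_nat.
by rewrite (@eq_khom _ _ _ _ G [ffun i => b (om i)] (b \o om)) // => i; rewrite ffunE.
Qed.

End Pairs.

(** * Splitting a part *)

Section Splitting.
Variables (R : realFieldType) (h k r : nat) (g : 'I_h -> 'I_k) (V : finType).
Variables (T : V -> 'I_r) (p : 'I_r).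
Hypotheses (gsurj : forall q, exists i, g i = q) (k2 : (2 <= k)%N).

Notation N := (#|V|%:R : R).
Notation m := (\sum_a (T a == p)%:R : R).

Definition multipartite : rel V := fun a b => T a != T b.

(** The blow-up of the multipartite graph that doubles each vertex, with the two copies of part [p]
    then joined completely to each other. *)
Definition split_part : rel (V * bool) := fun x y =>
  (T x.1 != T y.1) || ((T x.1 == p) && (x.2 != y.2)).

(** The preimage of part [p] under a homomorphism lies in a single class [q] of [H].
    Sending [q] and a second class [q2] into the two halves of [p] gives a
    homomorphism that exists only after the splitting; [sum_mix] counts these, by
    exchanging the values on [q] and [q2] with those of a random map. *)
Lemma split_part_gain :
  nkhom R g multipartite * m ^+ h <= k%:R * N ^+ h *
  \sum_(om : {ffun 'I_h -> V * bool})
     (khom g split_part om && ~~ khom g multipartite (fst \o om))%:R.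
Proof.
pose Z (om : {ffun 'I_h -> V * bool}) :=
  khom g split_part om && ~~ khom g multipartite (fst \o om).
rewrite -[X in _ <= _ * X]/(\sum_om (Z om)%:R).
pose good q (phi : {ffun 'I_h -> V}) :=
  khom g multipartite phi && [forall i, (T (phi i) == p) ==> (g i == q)].
have [q0 _] : exists q : 'I_k, true by exists (Ordinal (ltnW k2)).
have le_good : nkhom R g multipartite <= \sum_q \sum_phi (good q phi)%:R.
  rewrite exchange_big; apply: ler_sum => phi _ /=.
  have [H|_] := boolP (khom _ _ _); last by apply: sumr_ge0.
  have [q Hq] : exists q, good q phi.
    have [/existsP[i Hi]|] := boolP [exists i, T (phi i) == p].
      exists (g i); rewrite /good H; apply/forallP => j; apply/implyP => /eqP Hj.
      apply/negPn/negP => gji; have /khomP/(_ _ _ gji) := H.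
      by rewrite /multipartite Hj (eqP Hi) eqxx.
    rewrite negb_exists => /forallP H'; exists q0; rewrite /good H.
    by apply/forallP => i; apply/implyP => Hi; have := H' i; rewrite Hi.
  by rewrite (bigD1 q) //= Hq lerDl sumr_ge0.
apply: (@le_trans _ _ (\sum_(q < k) N ^+ h * \sum_om (Z om)%:R)); last first.
  by rewrite sum_cst card_ord mulrA.
apply: le_trans (ler_wpM2r _ le_good) _.
  by rewrite exprn_ge0 ?sumr_ge0.
rewrite mulr_suml; apply: ler_sum => q _.
have [q2 q2q] : exists q2 : 'I_k, q2 != q.
  have [e|ne] := eqVneq q (Ordinal (ltnW k2)); last by exists (Ordinal (ltnW k2)); rewrite eq_sym.
  by exists (Ordinal k2); rewrite e.
have -> : m ^+ h = \sum_(zeta : {ffun 'I_h -> V}) [forall i, T (zeta i) == p]%:R.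
  rewrite -[h in LHS]card_ord -prodr_const bigA_distr_bigA.
  by apply: eq_bigr => zeta _; rewrite prod_natb.
pose A i := (g i == q) || (g i == q2).
pose enc (phi : {ffun 'I_h -> V}) : {ffun 'I_h -> V * bool} := [ffun i => (phi i, g i == q)].
have enc_inj : injective enc.
  move=> f1 f2 /ffunP H; apply/ffunP => i; have := H i; rewrite !ffunE.
  by case.
apply: (@le_trans _ _ (N ^+ h * \sum_phi (Z (enc phi))%:R)); last first.
  rewrite ler_wpM2l ?exprn_ge0 //.
  exact: (ler_sum_inj (F := fun om => (Z om)%:R) enc_inj).
(* [zeta] supplies the values on the classes [q] and [q2], [phi] the others; the exchange costs the
   factor [N ^+ h]. *)
rewrite -[h in N ^+ h]card_ord -(sum_mix A (fun phi => (Z (enc phi))%:R)).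
rewrite mulr_suml; apply: ler_sum => phi _; rewrite mulr_sumr; apply: ler_sum => zeta _.
have [/andP[/khomP Hphi /forallP Hq]|_] := boolP (good q phi); last by rewrite mul0r.
have [/forallP Hz|_] := boolP [forall i, T (zeta i) == p]; last by rewrite mulr0.
rewrite mulr1; suff -> : Z (enc (mix A phi zeta)) by [].
apply/andP; split.
  apply/khomP => i j gij; rewrite /split_part !ffunE /A /=.
  have nq l : g l != q -> T (phi l) != p.
    by move=> gl; apply: contra gl => Hp; have /implyP := Hq l; apply.
  have [ei|ni] := eqVneq (g i) q; have [ej|nj] := eqVneq (g j) q => //=.
  - by rewrite ei ej eqxx in gij.
  - rewrite (eqP (Hz i)); case: ifP => [_|_]; first by rewrite (eqP (Hz j)) eqxx.
    by rewrite eq_sym nq.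
  - rewrite (eqP (Hz j)); case: ifP => [_|_]; first by rewrite (eqP (Hz i)) !eqxx orbT.
    by rewrite nq.
  case: ifP => ei; case: ifP => ej.
  - by move: gij; rewrite (eqP ei) (eqP ej) eqxx.
  - by rewrite (eqP (Hz i)) eq_sym nq.
  - by rewrite (eqP (Hz j)) nq.
  - by rewrite [_ != _](Hphi i j gij).
apply/negP => /khomP H; have [i gi] := gsurj q; have [j gj] := gsurj q2.
have gij : g i != g j by rewrite gi gj eq_sym.
have := H i j gij; rewrite /multipartite /= !ffunE /A gi gj !eqxx orbT /=.
by rewrite (eqP (Hz i)) (eqP (Hz j)) eqxx.
Qed.

(** The [2 ^+ h] lifts of each homomorphism to the multipartite graph survive the splitting, and the
    homomorphisms of [split_part_gain] are not among them. *)
Lemma split_part_count :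
  2 ^+ h * nkhom R g multipartite * (k%:R * N ^+ h) + nkhom R g multipartite * m ^+ h
  <= k%:R * N ^+ h * nkhom R g split_part.
Proof.
have -> : 2 ^+ h * nkhom R g multipartite =
    \sum_(om : {ffun 'I_h -> V * bool}) (khom g multipartite (fst \o om))%:R.
  transitivity (\sum_(phi : {ffun 'I_h -> V}) (khom g multipartite phi)%:R *
      \prod_i (\sum_(w : V * bool) (w.1 == phi i)%:R) : R).
    rewrite /nkhom mulr_sumr; apply: eq_bigr => phi _; rewrite mulrC; congr (_ * _).
    rewrite -[h in LHS]card_ord -prodr_const; apply: eq_bigr => i _.
    rewrite -(pair_bigA _ (fun a (s : bool) => (a == phi i)%:R)) /=.
    under eq_bigr do rewrite big_bool /= -mulr2n -[_ *+ 2]mulr_natl.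
    by rewrite -mulr_sumr sum_delta mulr1.
  rewrite (sum_pushforward fst (fun phi => (khom g multipartite phi)%:R)).
  apply: eq_bigr => om _; congr (_%:R); congr nat_of_bool.
  by apply: eq_khom => i; rewrite ffunE.
rewrite addrC; apply: le_trans (lerD split_part_gain (lexx _)) _.
rewrite [X in _ + X]mulrC -mulrDr ler_wpM2l ?mulr_ge0 ?exprn_ge0 //.
rewrite -big_split; apply: ler_sum => om _ /=.
have [/khomP H|_] := boolP (khom g multipartite _).
  suff -> : khom g split_part om by rewrite andbF add0r.
  by apply/khomP => i j gij; rewrite /split_part [_ != _](H i j gij).
by rewrite andbT addr0.
Qed.

End Splitting.

(** * Splitting a part along a light edge *)

Section Collapse.
Variables (R : realFieldType) (h k r : nat) (g : 'I_h -> 'I_k) (V : finType).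
Variables (G E : rel V) (T : V -> 'I_r) (eta t : R).
Hypotheses (gsurj : forall q, exists i, g i = q) (k2 : (2 <= k)%N).
Hypotheses (Gsym : symmetric G) (Esym : symmetric E) (EG : subrel E G).

Notation N := (#|V|%:R : R).
Let err a b := E a b != multipartite T a b.
Hypothesis errN : \sum_a \sum_b (err a b)%:R <= eta * N ^+ 2.

(** The map [rho] collapses the two halves of the split part to [u] and [w]; as [uw] is an edge of
    [G], most edges of the split graph go to edges of [G]. Homomorphisms avoiding the exceptional
    pairs [D] become homomorphisms to [G], bounded through [Lam]; the others are few by
    [sum_exists_pair]. *)
Lemma collapse_part (Lam : R) u w : khom_bound g G Lam -> G u w -> T u = T w ->
  \sum_b (err u b)%:R <= t * N -> \sum_b (err w b)%:R <= t * N ->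
  2 ^+ h * nkhom R g (multipartite T) * (k%:R * N ^+ h) +
    nkhom R g (multipartite T) * (\sum_a (T a == T u)%:R) ^+ h
  <= k%:R * N ^+ h * ((Lam + h%:R ^+ 2 * (eta + 2 * t)) * (2 * N) ^+ h).
Proof.
move=> bd Guw Tuw eu ew; set p := T u.
have N0 : 0 < N by rewrite ltr0n; apply/card_gt0P; exists u.
apply: le_trans (split_part_count R T p gsurj k2) _.
rewrite ler_wpM2l ?mulr_ge0 ?exprn_ge0 //.
pose rho (x : V * bool) := if T x.1 == p then (if x.2 then u else w) else x.1.
pose D x y := split_part T p x y && ~~ G (rho x) (rho y).
have cardW : #|{: V * bool}|%:R = 2 * N by rewrite card_prod card_bool natrM mulrC.
have sumW (F : V -> bool -> R) : \sum_(x : V * bool) F x.1 x.2 = \sum_a (F a true + F a false).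
  by rewrite -(pair_bigA _ F); apply: eq_bigr => a _; rewrite big_bool.
have rhoT x : T (rho x) = T x.1.
  by rewrite /rho; case: eqP => [->|//]; case: x.2.
have rhoG x y : T x.1 != T y.1 -> ~~ G (rho x) (rho y) -> err (rho x) (rho y).
  move=> Txy nG; rewrite /err /multipartite !rhoT Txy eqb_id.
  by apply: contra nG; apply: EG.
have errC a b : err a b = err b a by rewrite /err /multipartite Esym [T a == _]eq_sym.
pose far (s : bool) b : R := (err (if s then u else w) b)%:R.
have farN s : \sum_b far s b <= t * N by case: s.
have DN : \sum_x \sum_y (D x y)%:R <= 4 * (eta + 2 * t) * N ^+ 2.
  apply: (@le_trans _ _ (\sum_(x : V * bool) \sum_(y : V * bool)
    ((err x.1 y.1)%:R + far x.2 y.1 + far y.2 x.1))).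
    apply: ler_sum => x _; apply: ler_sum => y _.
    have f0 s b : 0 <= far s b by [].
    have [/andP[/orP[Txy|/andP[/eqP Tx xy]] nG]|_] := boolP (D x y); last by rewrite !addr_ge0.
      have := rhoG _ _ Txy nG; rewrite {1}/rho.
      case: eqP => Hx; rewrite /rho.
        have -> : (T y.1 == p) = false by apply: contraNF Txy => /eqP ->; rewrite Hx.
        by rewrite /far => ->; rewrite addrAC ler_wpDl ?addr_ge0.
      case: eqP => Hy; last by move=> ->; rewrite -addrA ler_wpDr ?addr_ge0.
      by rewrite errC /far => ->; rewrite ler_wpDl ?addr_ge0.
    have [Ty|Ty] := eqVneq (T y.1) p.
      move: nG; rewrite /rho Tx Ty eqxx; case: (x.2) xy; case: (y.2) => //= _.
        by rewrite Guw.
      by rewrite Gsym Guw.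
    have Txy : T x.1 != T y.1 by rewrite Tx eq_sym.
    have := rhoG _ _ Txy nG; rewrite /rho Tx eqxx (negPf Ty).
    by rewrite /far => ->; rewrite addrAC ler_wpDl ?addr_ge0.
  under eq_bigr do rewrite !big_split /=.
  rewrite !big_split /=.
  have -> : \sum_(x : V * bool) \sum_(y : V * bool) (err x.1 y.1)%:R =
      4 * (\sum_a \sum_b (err a b)%:R) :> R.
    rewrite (sumW (fun a _ => \sum_y (err a y.1)%:R)) mulr_sumr; apply: eq_bigr => a _.
    rewrite (sumW (fun b _ => (err a b)%:R)) big_split /=; ring.
  have -> : \sum_(x : V * bool) \sum_(y : V * bool) far x.2 y.1 =
      2 * N * (\sum_b far true b + \sum_b far false b).
    rewrite (sumW (fun _ s => \sum_y far s y.1)) sum_cst !(sumW (fun b _ => far _ b)).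
    by rewrite !big_split /=; ring.
  have -> : \sum_(x : V * bool) \sum_(y : V * bool) far y.2 x.1 =
      2 * N * (\sum_b far true b + \sum_b far false b).
    rewrite exchange_big (sumW (fun _ s => \sum_y far s y.1)) sum_cst /=.
    by rewrite !(sumW (fun b _ => far _ b)) !big_split /=; ring.
  have /(ler_wpM2l (ltW N0)) := farN true; set F1 := \sum_b far true b.
  have /(ler_wpM2l (ltW N0)) := farN false; set F2 := \sum_b far false b.
  by move: errN; set S := \sum_a _; lra.
apply: (@le_trans _ _ (\sum_(om : {ffun 'I_h -> V * bool}) (khom g G (rho \o om))%:R +
  \sum_(om : {ffun 'I_h -> V * bool})
    [exists i, exists j, (g i != g j) && D (om i) (om j)]%:R)).
  rewrite -big_split; apply: ler_sum => om _ /=.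
  have [/khomP H|_] := boolP (khom g (split_part T p) om); last by rewrite addr_ge0.
  have [_|nG] := boolP (khom g G _); first by rewrite lerDl.
  suff -> : [exists i, exists j, (g i != g j) && D (om i) (om j)] by rewrite add0r.
  move: nG; rewrite negb_forall => /existsP[i]; rewrite negb_forall => /existsP[j].
  rewrite negb_imply => /andP[gij nG]; apply/existsP; exists i; apply/existsP; exists j.
  by rewrite gij /D H.
rewrite mulrDl; apply: lerD.
  by rewrite -cardW; apply: khom_bound_blowup.
have W2 : 0 < (2 * N) ^+ 2 by rewrite exprn_gt0 // mulr_gt0.
rewrite -(ler_pM2r W2); have := sum_exists_pair R g D; rewrite cardW => /le_trans; apply.
have -> : h%:R ^+ 2 * (eta + 2 * t) * (2 * N) ^+ h * (2 * N) ^+ 2 =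
  h%:R ^+ 2 * (4 * (eta + 2 * t) * N ^+ 2) * (2 * N) ^+ h by ring.
by rewrite ler_wpM2r ?exprn_ge0 ?mulr_ge0 // ler_wpM2l ?sqr_ge0.
Qed.

(** Otherwise every light edge is a pair on which [E] and [T] disagree, or has an end in too many
    such pairs, or lies in a small part. These cases account for at most [t ^+ 2], [2 * t] and [p0]
    times [N ^+ 2] pairs. *)
Lemma typical_light_edge (p0 xi : R) : (0 < #|V|)%N -> 0 < t -> 0 <= p0 -> eta = t ^+ 2 ->
  t ^+ 2 + 2 * t + p0 <= xi -> xi * N ^+ 2 < \sum_a \sum_b (G a b && ~~ E a b)%:R ->
  exists u w, [/\ G u w, T u = T w, \sum_b (err u b)%:R <= t * N,
    \sum_b (err w b)%:R <= t * N & p0 * N < \sum_a (T a == T u)%:R].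
Proof.
move=> V0 t0 p00 eE xiE big.
have N0 : 0 < N by rewrite ltr0n.
pose deg a : R := \sum_b (err a b)%:R.
pose sz a : R := \sum_b (T b == T a)%:R.
pose X a := t * N < deg a.
pose P u w := [&& G u w, T u == T w, ~~ X u, ~~ X w & p0 * N < sz u].
case: (boolP [exists u, exists w, P u w]) => [/existsP[u /existsP[w]]|].
  case/and5P => Guw /eqP Tuw; rewrite -!leNgt => Xu Xw szu.
  by exists u, w; split.
rewrite negb_exists => /forallP nP; exfalso.
have XN : \sum_a (X a)%:R <= t * N.
  have tN : 0 < t * N by rewrite mulr_gt0.
  rewrite -(ler_pM2l tN) mulr_sumr; apply: (@le_trans _ _ (\sum_a deg a)).
    apply: ler_sum => a _; have [/ltW|_] := boolP (X a); first by rewrite mulr1.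
    by rewrite mulr0 sumr_ge0.
  by apply: le_trans errN _; rewrite eE; lra.
have : \sum_a \sum_b (G a b && ~~ E a b)%:R <=
  \sum_a \sum_b ((err a b)%:R + (X a)%:R + (X b)%:R +
    (sz a <= p0 * N)%R%:R * (T b == T a)%:R) :> R.
  apply: ler_sum => a _; apply: ler_sum => b _.
  have [/andP[Gab Eab]|_] := boolP (_ && _); last by rewrite !addr_ge0 ?mulr_ge0.
  have := nP a; rewrite negb_exists => /forallP/(_ b); rewrite /P Gab /=.
  rewrite /err /multipartite (negPf Eab) [sz a <= _]leNgt [T b == _]eq_sym.
  by case: (T a == T b); case: (X a); case: (X b); case: (_ < sz a) => //= _; lra.
under [X in _ <= X]eq_bigr do rewrite !big_split /= sum_cst.
rewrite !big_split /= -mulr_sumr sum_cst.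
have : \sum_a \sum_b (sz a <= p0 * N)%R%:R * (T b == T a)%:R <= p0 * N ^+ 2 :> R.
  rewrite expr2 mulrCA -sum_cst; apply: ler_sum => a _; rewrite -mulr_sumr -/(sz a).
  by have [H|_] := boolP (sz a <= p0 * N); rewrite ?mul1r // mul0r mulr_ge0.
have : N * (\sum_a (X a)%:R) <= N * (t * N) by rewrite ler_pM2l.
have : (t ^+ 2 + 2 * t + p0) * N ^+ 2 <= xi * N ^+ 2 by rewrite ler_wpM2r ?sqr_ge0.
move: big errN; rewrite eE; set A := \sum_a \sum_b _; set B := \sum_a \sum_b _.
set C := \sum_a _; set D := \sum_a \sum_b _; lra.
Qed.

End Collapse.

Lemma small_pos (R : realFieldType) (a b : R) : 0 < a -> 0 < b ->
  exists x, [/\ 0 < x, x <= a & x <= b].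
Proof.
by move=> a0 b0; exists (Num.min a b); split; rewrite ?lt_min ?a0 ?ge_min ?lexx ?orbT.
Qed.

(** * Stability for homomorphism counts *)

(** Too many light edges would give a typical one in a part of size over [p0 * N]. Splitting that
    part raises the normalised count by a factor of at least [1 + p0 ^+ h / Q], while [E] already
    nearly attains [Lam]; this contradicts [collapse_part]. *)
Lemma few_light_edges (R : realFieldType) (h k r : nat) (tau xi : R) :
  (2 <= k)%N -> 0 < tau -> 0 < xi ->
  exists t d : R, [/\ 0 < t, t <= 1, t <= xi & 0 < d] /\
  forall (g : 'I_h -> 'I_k) (V : finType) (G E : rel V) (T : V -> 'I_r) (Lam : R),
  (forall q, exists i, g i = q) -> (0 < #|V|)%N ->
  symmetric G -> symmetric E -> subrel E G ->
  khom_bound g G Lam -> tau <= Lam -> (Lam - d) * #|V|%:R ^+ h <= nkhom R g E ->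
  \sum_a \sum_b (E a b != multipartite T a b)%:R <= t ^+ 2 * #|V|%:R ^+ 2 ->
  \sum_a \sum_b (G a b && ~~ E a b)%:R <= xi * #|V|%:R ^+ 2.
Proof.
move=> k2 tau0 xi0; pose p0 := xi / 4; pose Q : R := k%:R * 2 ^+ h.
have p00 : 0 < p0 by rewrite divr_gt0.
have k0 : 0 < k%:R :> R by rewrite ltr0n (ltn_trans _ k2).
have Q0 : 0 < Q by rewrite mulr_gt0 ?exprn_gt0.
(* [gam * Q] bounds the gain from below, since [Lam - D >= tau / 2]; [d] and [t] are then taken so
   small that the total loss [d + 2 * H2 * (t ^+ 2 + t)] stays below [gam]. *)
pose gam := tau * p0 ^+ h / (2 * Q).
have gam0 : 0 < gam by rewrite divr_gt0 // mulr_gt0 // exprn_gt0.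
have [d [d0 dg dt]] := small_pos (divr_gt0 gam0 (ltr0n R 4)) (divr_gt0 tau0 (ltr0n R 4)).
pose H2 : R := h%:R ^+ 2.
have H20 : 0 <= H2 by rewrite sqr_ge0.
have [t1 [t10 t1x t11]] := small_pos (divr_gt0 xi0 (ltr0n R 8)) (@ltr01 R).
have H80 : 0 < 8 * (H2 + 1) by lra.
have [t2 [t20 t2g t2t]] := small_pos (divr_gt0 gam0 H80) (divr_gt0 tau0 H80).
have [t [t0 tt1 tt2]] := small_pos t10 t20.
have Htg : t * (8 * (H2 + 1)) <= gam by rewrite -ler_pdivlMr //; lra.
have Htt : t * (8 * (H2 + 1)) <= tau by rewrite -ler_pdivlMr //; lra.
have t1' : t <= 1 by lra.
have Ht0 : 0 <= H2 * t by rewrite mulr_ge0 // ltW.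
have Ht2 : H2 * t ^+ 2 <= H2 * t by rewrite ler_wpM2l // expr2 ger_pMl.
have tsq : t ^+ 2 <= t by rewrite expr2 ger_pMl.
exists t, d; split; first by split => //; lra.
move=> g V G E T Lam gs V0 Gs Es EG bd tauL near errN.
rewrite leNgt; apply/negP => big.
have N0 : 0 < #|V|%:R :> R by rewrite ltr0n.
have xiE : t ^+ 2 + 2 * t + p0 <= xi by rewrite /p0; lra.
have [u [w [Guw Tuw eu ew szu]]] :=
  typical_light_edge errN V0 t0 (ltW p00) (erefl _) xiE big.
have := collapse_part gs k2 Gs Es EG errN bd Guw Tuw eu ew.
have := @nkhom_diff R h k g V E (multipartite T) V0.
set K := nkhom R g (multipartite T); set S := \sum_a \sum_b _ in errN *.
move: near szu; set m := \sum_a _; set N := #|V|%:R in N0 errN *; set X := N ^+ h.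
have X0 : 0 < X by rewrite exprn_gt0.
move=> near szu Kdiff.
have {Kdiff} KE : (Lam - d - H2 * t ^+ 2) * X <= K.
  have : nkhom R g E * N ^+ 2 <= (K + H2 * t ^+ 2 * X) * N ^+ 2.
    apply: le_trans Kdiff _; rewrite mulrDl lerD2l.
    have -> : H2 * t ^+ 2 * X * N ^+ 2 = H2 * (t ^+ 2 * N ^+ 2) * X by ring.
    by rewrite -/H2 ler_wpM2r ?(ltW X0) // ler_wpM2l.
  rewrite ler_pM2r ?exprn_gt0 //; lra.
have mX : p0 ^+ h * X <= m ^+ h.
  rewrite -exprMn lerXn2r ?nnegrE ?(ltW szu) //; last exact: sumr_ge0.
  by rewrite mulr_ge0 ?ltW.
pose D := d + H2 * t ^+ 2.
have LD : tau / 2 <= Lam - D by rewrite /D; lra.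
have K0 : 0 <= K by apply: le_trans KE; rewrite mulr_ge0 ?(ltW X0) //; rewrite /D in LD; lra.
rewrite exprMn -/X -/H2 => coll.
have {}coll : K * (Q + p0 ^+ h) <= Q * (Lam + H2 * (t ^+ 2 + 2 * t)) * X.
  rewrite -(ler_pM2r X0); have : K * (p0 ^+ h * X) <= K * m ^+ h by rewrite ler_wpM2l.
  move: coll; rewrite /Q; lra.
have P0 : 0 < p0 ^+ h by rewrite exprn_gt0.
have {}coll : (Lam - D) * (Q + p0 ^+ h) <= Q * (Lam + H2 * (t ^+ 2 + 2 * t)).
  rewrite -(ler_pM2r X0); apply: le_trans coll.
  rewrite mulrAC ler_wpM2r ?addr_ge0 ?(ltW Q0) ?(ltW P0) //.
  by apply: le_trans KE; rewrite /D opprD addrA.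
have gamE : gam * Q = tau / 2 * p0 ^+ h.
  by rewrite /gam; field; rewrite gt_eqF.
have : tau / 2 * p0 ^+ h <= (Lam - D) * p0 ^+ h by rewrite ler_pM2r.
rewrite -gamE => H.
have : gam * Q <= (D + H2 * (t ^+ 2 + 2 * t)) * Q by lra.
by rewrite ler_pM2r // /D; lra.
Qed.

(** A homomorphism lost in passing to the heavy graph uses a light pair; there are at most [N ^+ 2]
    such pairs, each used fewer than [c N^(h-2)] times. *)
Lemma nkhom_heavy (R : realType) h k (g : 'I_h -> 'I_k) (V : finType) (G : rel V) (c : R) :
  (0 < #|V|)%N -> 0 <= c ->
  nkhom R g G <= nkhom R g (heavy g G c) + c * #|V|%:R ^+ h.
Proof.
move=> V0 c0; set N : R := #|V|%:R.
have N0 : 0 < N by rewrite ltr0n.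
pose L a b : R := (~~ heavy g G c a b)%:R.
have : \sum_(phi : {ffun 'I_h -> V}) (khom g G phi)%:R *
    (\sum_i \sum_(j | g i != g j) L (phi i) (phi j)) <= c * N ^+ h.
  rewrite sum_edge_weight -(ler_pM2r (_ : 0 < N ^+ 2)) ?exprn_gt0 //.
  have -> : c * N ^+ h * N ^+ 2 = \sum_(a : V) \sum_(b : V) c * N ^+ h.
    by rewrite !sum_cst; ring.
  rewrite mulr_suml; apply: ler_sum => a _; rewrite mulr_suml; apply: ler_sum => b _.
  rewrite /L; have [hv|] := boolP (heavy g G c a b).
    by rewrite !mul0r mulr_ge0 ?exprn_ge0.
  by rewrite mul1r -ltNge => /ltW.
move=> /(lerD (lexx (nkhom R g (heavy g G c)))); apply: le_trans.
rewrite -big_split; apply: ler_sum => phi _ /=.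
have s0 i : 0 <= \sum_(j | g i != g j) L (phi i) (phi j) by apply: sumr_ge0.
have [_|_] := boolP (khom g G phi); last by rewrite mul0r addr0.
rewrite mul1r; have [_|nE] := boolP (khom g (heavy g G c) phi); first by rewrite lerDl sumr_ge0.
move: nE; rewrite negb_forall => /existsP[i]; rewrite negb_forall => /existsP[j].
rewrite negb_imply => /andP[gij nE].
rewrite add0r (bigD1 i) //= (bigD1 j) //= {1}/L nE -addrA lerDl addr_ge0 ?sumr_ge0 //.
Qed.

(** [few_bad_triples] and [near_multipartite] give [T] for the heavy graph; [few_light_edges] then
    applies, the heavy graph having almost as many homomorphisms as [G]. *)
Lemma hom_stability (R : realType) (h k r : nat) (tau eps : R) :
  (2 <= k)%N -> 0 < tau -> 0 < eps ->
  exists2 d : R, 0 < d &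
  forall (g : 'I_h -> 'I_k) (V : finType) (G : rel V) (Lam : R),
  (forall q, exists i, g i = q) -> (0 < #|V|)%N -> symmetric G -> irreflexive G ->
  clique_free r.+1 G -> khom_bound g G Lam -> tau <= Lam ->
  (Lam - d) * #|V|%:R ^+ h <= nkhom R g G ->
  exists T : V -> 'I_r.+1,
    \sum_a \sum_b (G a b != multipartite T a b)%:R <= eps * #|V|%:R ^+ 2.
Proof.
move=> k2 tau0 eps0.
have [t [d1 [[t0 t1 te d10] light]]] := few_light_edges h r.+1 k2 tau0 (divr_gt0 eps0 (ltr0n R 2)).
pose A : R := 3 * r.+1%:R + 4.
have A0 : 0 < A by rewrite addr_gt0 // mulr_gt0 // ltr0n.
(* The error [A * th] of [near_multipartite] becomes the [t ^+ 2] that [few_light_edges] asks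
   for. *)
pose th := t ^+ 2 / A.
have th0 : 0 < th by rewrite divr_gt0 ?exprn_gt0.
(* [eta <= th ^+ 2] bounds the bad triples; [eta <= d1 / 2] bounds the threshold [c], hence the loss
   in [nkhom_heavy]. *)
have [eta [eta0 eta1 etad]] := small_pos (exprn_gt0 2 th0) (divr_gt0 d10 (ltr0n R 2)).
have [d2 d20 few] := few_bad_triples h eta0.
have [d [d0 dd1 dd2]] := small_pos (divr_gt0 d10 (ltr0n R 2)) d20.
exists d => // g V G Lam gs V0 Gs Gi Gcf bd tauL near.
have N0 : 0 < #|V|%:R :> R by rewrite ltr0n.
have X0 : 0 < #|V|%:R ^+ h :> R by rewrite exprn_gt0.
have near2 : (Lam - d2) * #|V|%:R ^+ h <= nkhom R g G.
  by apply: le_trans near; rewrite ler_wpM2r ?(ltW X0) // lerD2l lerN2.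
have [c /andP[c0 ceta] triples] := few _ g V G Lam Gs bd near2.
pose E := heavy g G c.
have Es : symmetric E by apply: heavyC.
have EG : subrel E G by move=> a b; apply: heavy_edge.
have Ei : irreflexive E by move=> a; apply/negP => /EG; rewrite Gi.
have Ecf : clique_free r.+1 E := clique_freeW EG Gcf.
have [|T errT] := @near_multipartite R V E r th Es Ei Ecf th0.
  by apply: le_trans triples _; rewrite ler_wpM2r ?exprn_ge0.
exists T.
have {}errT : \sum_a \sum_b (E a b != multipartite T a b)%:R <= t ^+ 2 * #|V|%:R ^+ 2 :> R.
  apply: le_trans errT _; rewrite -/A /th le_eqVlt; apply/orP; left; apply/eqP.
  by field; rewrite gt_eqF.
have := light g V G E T Lam gs V0 Gs Es EG bd tauL _ errT.
have H := nkhom_heavy g G V0 (ltW c0).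
have : c * #|V|%:R ^+ h <= d1 / 2 * #|V|%:R ^+ h by rewrite ler_wpM2r ?(ltW X0) //; lra.
have : (Lam - d1 / 2) * #|V|%:R ^+ h <= (Lam - d) * #|V|%:R ^+ h.
  by rewrite ler_wpM2r ?(ltW X0) //; lra.
move=> H1 H2 /(_ _) H3.
have {}H3 := H3 ltac:(lra).
apply: (@le_trans _ _ (\sum_a \sum_b (G a b && ~~ E a b)%:R +
   \sum_a \sum_b (E a b != multipartite T a b)%:R)).
  rewrite -big_split; apply: ler_sum => a _ /=; rewrite -big_split; apply: ler_sum => b _ /=.
  have := EG a b; case: (E a b) => [-> //|_]; first by rewrite add0r.
  by case: (G a b); case: (multipartite T a b) => //=; lra.
apply: le_trans (lerD H3 errT) _; rewrite -mulrDl ler_wpM2r ?sqr_ge0 //.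
have : t ^+ 2 <= t by rewrite expr2 ger_pMl.
lra.
Qed.

(** * Copies of H and blow-ups *)

Definition adj n (G : {set {set 'I_n}}) : rel 'I_n := fun a b => [set a; b] \in G.

Lemma adjC n (G : {set {set 'I_n}}) : symmetric (adj G).
Proof. by move=> a b; rewrite /adj setUC. Qed.

Lemma adj_irr n (G : {set {set 'I_n}}) : is_graph G -> irreflexive (adj G).
Proof.
by move=> /forall_inP gG a; apply/negP => /gG; rewrite setUid cards1.
Qed.

Definition blowup n (V : Type) (E : rel V) (f : 'I_n -> V) : {set {set 'I_n}} :=
  [set [set x; y] | x in 'I_n, y in 'I_n & E (f x) (f y)].

Lemma adj_blowup n (V : Type) (E : rel V) (f : 'I_n -> V) a b :
  symmetric E -> adj (blowup E f) a b = E (f a) (f b).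
Proof.
move=> Es; apply/imset2P/idP => [[x y _ /=]|Eab]; last by exists a b => //; rewrite inE.
rewrite inE => Exy /setP eq.
have /orP[/eqP ya|/eqP yb] : (y == a) || (y == b) by have := eq y; rewrite !inE eqxx orbT.
  have /orP[/eqP bx|/eqP by_] : (b == x) || (b == y) by have := eq b; rewrite !inE eqxx orbT.
    by rewrite bx -ya Es.
  have /orP[/eqP xa|/eqP xb] : (x == a) || (x == b) by have := eq x; rewrite !inE eqxx.
    by rewrite by_ -{1}xa.
  by rewrite -xb -ya Es.
have /orP[/eqP ax|/eqP ay] : (a == x) || (a == y) by have := eq a; rewrite !inE eqxx.
  by rewrite ax -yb.
have /orP[/eqP xa|/eqP xb] : (x == a) || (x == b) by have := eq x; rewrite !inE eqxx.
  by rewrite -xa -yb.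
by rewrite ay -xb Es.
Qed.

Lemma blowup_graph n (V : Type) (E : rel V) (f : 'I_n -> V) :
  irreflexive E -> is_graph (blowup E f).
Proof.
move=> Ei; apply/forall_inP => e /imset2P[x y _]; rewrite inE => Exy ->.
by rewrite cards2; have [xy|//] := eqVneq x y; rewrite xy Ei in Exy.
Qed.

Lemma imset_cmp_graph h k n (g : 'I_h -> 'I_k) (G : {set {set 'I_n}}) (phi : 'I_h -> 'I_n) :
  ([set phi @: (e : {set 'I_h}) | e in cmp_graph g] \subset G) = khom g (adj G) phi.
Proof.
apply/subsetP/khomP => [H i j gij | H e /imsetP[e' /imset2P[x y _]]].
  apply: H; apply/imsetP; exists [set i; j]; last by rewrite imsetU !imset_set1.
  by apply/imset2P; exists i j; rewrite ?inE.
by rewrite inE => gxy -> ->; rewrite imsetU !imset_set1; apply: (H x y).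
Qed.

Section Copies.
Variables (h : nat) (H : {set {set 'I_h}}).

Definition automorphisms : {set {perm 'I_h}} := [set s | relabel s H == H].

Lemma automorphisms_gt0 : (0 < #|automorphisms|)%N.
Proof.
apply/card_gt0P; exists 1%g; rewrite inE; apply/eqP/setP => e.
have im1 (A : {set 'I_h}) : (1%g : {perm 'I_h}) @: A = A.
  by rewrite -[RHS]imset_id; apply: eq_imset => x; rewrite perm1.
apply/imsetP/idP => [[e' e'H ->]|eH]; first by rewrite im1.
by exists e; rewrite ?im1.
Qed.

(** Two injective maps give the same copy exactly when they differ by an automorphism of [H], so the
    fibres over the copies all have the same size. *)
Lemma card_copies n (G : {set {set 'I_n}}) :
  #|[set phi : {ffun 'I_h -> 'I_n} |
      injectiveb phi && ([set phi @: (e : {set 'I_h}) | e in H] \subset G)]|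
  = (#|automorphisms| * Ncopies H G)%N.
Proof.
pose edges (phi : 'I_h -> 'I_n) := [set phi @: (e : {set 'I_h}) | e in H].
pose f (phi : {ffun 'I_h -> 'I_n}) := (phi @: 'I_h, edges phi).
rewrite /Ncopies; set D := [set phi | _]; set S := [set p | _].
have SP p : reflect (exists2 phi : {ffun 'I_h -> 'I_n}, injectiveb phi & p = f phi /\ edges phi \subset G)
    (p \in S).
  rewrite inE; apply: (iffP andP) => [[/existsP[phi /and3P[iphi /eqP p1 /eqP p2]] sG]|].
    by exists phi => //; rewrite /f /edges -p1 -p2; case: p {p1 p2} sG.
  move=> [phi iphi [-> sG]]; split => //; apply/existsP; exists phi.
  by rewrite iphi !eqxx.
rewrite -sum1_card (partition_big f (mem S)) /=; last first.
  move=> phi; rewrite inE => /andP[iphi sG]; apply/SP; by exists phi.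
transitivity (\sum_(p in S) #|automorphisms|)%N; last by rewrite sum_nat_const mulnC.
apply: eq_bigr => _ /SP[phi0 /injectiveP i0 [-> sG]].
rewrite sum1dep_card.
pose F (s : {perm 'I_h}) : {ffun 'I_h -> 'I_n} := [ffun i => phi0 (s i)].
have Finj : injective F.
  move=> s1 s2 /ffunP e; apply/permP => i; apply: i0.
  by have := e i; rewrite !ffunE.
have imF (s : {perm 'I_h}) (A : {set 'I_h}) : F s @: A = phi0 @: (s @: A).
  by rewrite -imset_comp; apply: eq_imset => i; rewrite ffunE.
have edgesF s : edges (F s) = [set phi0 @: (e : {set 'I_h}) | e in relabel s H].
  rewrite /edges /relabel -imset_comp; apply: eq_imset => e; exact: imF.
rewrite -(card_imset _ Finj); apply: eq_card => phi; rewrite !inE.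
apply/andP/imsetP => [[/andP[/injectiveP iphi _] /eqP[im ed]]|[s]].
  have ex i : exists j, phi0 j == phi i.
    have : phi i \in phi @: 'I_h by apply: imset_f.
    by rewrite im => /imsetP[j _ ->]; exists j.
  pose s0 i := xchoose (ex i).
  have s0E i : phi0 (s0 i) = phi i by apply/eqP; apply: (xchooseP (ex i)).
  have s0i : injective s0 by move=> i j e; apply: iphi; rewrite -!s0E e.
  have phiE : phi = F (perm s0i) by apply/ffunP => i; rewrite ffunE permE s0E.
  exists (perm s0i) => //; rewrite inE; apply/eqP.
  apply: (imset_inj (imset_inj i0)); rewrite -/(edges phi0) -ed phiE.
  by rewrite edgesF.
rewrite inE => /eqP sH ->.
have ed : edges (F s) = edges phi0 by rewrite edgesF sH.
have iF : injective (F s) by move=> i j; rewrite !ffunE => /i0/perm_inj.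
split; first by apply/andP; split; [apply/injectiveP | rewrite -/(edges _) ed].
apply/eqP; congr (_, _) => //.
apply/setP => y; apply/imsetP/imsetP => [[i _ ->]|[i _ ->]].
  by exists (s i); rewrite ?ffunE.
by exists (s^-1%g i); rewrite ?ffunE ?permKV.
Qed.

End Copies.

(** [Kgraph] is the complete multipartite graph of the identity map, so its embeddings are
    homomorphisms; irreflexivity of [adj G] makes homomorphisms injective. *)
Lemma Ffree_clique r n (G : {set {set 'I_n}}) : is_graph G ->
  reflect (clique_free r (adj G)) (Ffree (Kgraph r.+1) G).
Proof.
move=> gG; have A0 := automorphisms_gt0 (Kgraph r.+1).
rewrite /Ffree -(eqn_pmul2l A0) muln0 -card_copies cards_eq0.
have KE (phi : 'I_r.+1 -> 'I_n) :
    ([set phi @: (e : {set 'I_r.+1}) | e in Kgraph r.+1] \subset G) = khom id (adj G) phi.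
  exact: (imset_cmp_graph id).
apply: (iffP eqP) => [/setP e0 phi | cf].
  apply/negP => H; have := e0 (finfun phi); rewrite !inE KE => /negbT/negP; apply.
  have kh : khom id (adj G) (finfun phi).
    by rewrite (@eq_khom _ _ _ _ _ _ phi) // => i; rewrite ffunE.
  rewrite kh andbT; apply/injectiveP => i j eij; apply/eqP/negPn/negP => ij.
  by have /khomP/(_ _ _ ij) := kh; rewrite eij adj_irr.
apply/setP => phi; rewrite !inE KE; apply/negP => /andP[_ H].
by have /negP := cf phi; apply.
Qed.

(** * Random blow-ups and the extremal number *)

Section RandomBlowup.
Variables (R : realFieldType) (h n : nat) (V : finType).

(** Under a product weight the coordinates selected by [psi] are independent, and each of the other
    [n - h] contributes a factor [\sum_v x v]. *)
Lemma sum_marginal (x : V -> R) (psi : 'I_h -> 'I_n) (F : {ffun 'I_h -> V} -> R) :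
  injective psi ->
  \sum_(f : {ffun 'I_n -> V}) (\prod_a x (f a)) * F [ffun i => f (psi i)] =
  (\sum_v x v) ^+ (n - h) * \sum_phi F phi * \prod_i x (phi i).
Proof.
move=> ipsi; set s := \sum_v x v.
transitivity (\sum_phi \sum_(f : {ffun 'I_n -> V})
    (([ffun i => f (psi i)] : {ffun 'I_h -> V}) == phi)%:R * ((\prod_a x (f a)) * F phi)).
  rewrite exchange_big; apply: eq_bigr => f _ /=.
  rewrite -(sum_eq1 (fun phi => (\prod_a x (f a)) * F phi)).
  by apply: eq_bigr => phi _; rewrite eq_sym.
rewrite mulr_sumr; apply: eq_bigr => phi _.
have -> : \sum_(f : {ffun 'I_n -> V})
    (([ffun i => f (psi i)] : {ffun 'I_h -> V}) == phi)%:R * ((\prod_a x (f a)) * F phi)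
  = F phi * \prod_a \sum_v (x v * \prod_(i | psi i == a) (v == phi i)%:R).
  rewrite bigA_distr_bigA mulr_sumr; apply: eq_bigr => f _ /=.
  rewrite big_split /= mulrC -mulrA mulrCA; congr (_ * (_ * _)).
  rewrite (exchange_big_dep predT) //=.
  transitivity (\prod_i (f (psi i) == phi i)%:R : R).
    rewrite prod_natb; congr (nat_of_bool _)%:R; apply/eqP/forallP => [<- i|H].
      by rewrite ffunE.
    by apply/ffunP => i; rewrite ffunE; apply/eqP.
  apply: eq_bigr => i _; rewrite (bigD1 (psi i)) //= big1 ?mulr1 // => a /andP[/eqP ->].
  by rewrite eqxx.
rewrite mulrCA; congr (_ * _).
rewrite (bigID (fun a => a \in psi @: 'I_h)) /= mulrC; congr (_ * _).
  rewrite (eq_bigr (fun=> s)); last first.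
    move=> a na; apply: eq_bigr => v _; rewrite big1 ?mulr1 // => i /eqP ia.
    by move: na; rewrite -ia imset_f.
  rewrite prodr_const; congr (_ ^+ _).
  have := cardC (mem (psi @: 'I_h)); rewrite card_ord card_imset // card_ord => e.
  transitivity #|[predC psi @: 'I_h]|; first by apply: eq_card => a; rewrite !inE.
  by move: e; set c := #|_|; lia.
rewrite big_imset /=; last by move=> i j _ _ /ipsi.
apply: eq_bigr => i _; rewrite -[RHS](sum_eq1 x); apply: eq_bigr => v _.
rewrite mulrC (bigD1 i) //= big1 ?mulr1 // => j /andP[/eqP/ipsi ->].
by rewrite eqxx.
Qed.

End RandomBlowup.

Section ExtremalBound.
Variables (R : realFieldType) (h k n r : nat) (g : 'I_h -> 'I_k).
Hypotheses (h0 : (0 < h)%N) (hn : (h <= n)%N).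

Notation H := (cmp_graph g).
Notation A := #|automorphisms H|.
Notation ex := (ex_gen n H (Kgraph r.+1)).

Lemma ffact_pos : 0 < (n ^_ h)%:R :> R.
Proof. by rewrite ltr0n ffact_gt0. Qed.

Lemma copies_le_hom (G : {set {set 'I_n}}) :
  (A * Ncopies H G)%:R <= nkhom R g (adj G).
Proof.
rewrite -card_copies -sum1_card natr_sum big_mkcond; apply: ler_sum => phi _ /=.
by rewrite inE imset_cmp_graph; case: (injectiveb phi); case: (khom _ _ _).
Qed.

Lemma copies_le_ffact (G : {set {set 'I_n}}) : (A * Ncopies H G <= n ^_ h)%N.
Proof.
rewrite -card_copies -[h in X in (_ <= X)%N]card_ord -[n in X in (_ <= X)%N]card_ord.
rewrite -card_inj_ffuns; apply: subset_leq_card; apply/subsetP => phi.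
by rewrite !inE => /andP[].
Qed.

Lemma ex_le_ffact : (A * ex <= n ^_ h)%N.
Proof.
rewrite /ex_gen; elim/big_ind: _ => [|x y Hx Hy|G _]; first by rewrite muln0.
  by rewrite maxnMr geq_max Hx.
exact: copies_le_ffact.
Qed.

(** Average over the blow-ups along a random map ['I_n -> V] whose values are
    independent with law proportional to [x]. *)
Lemma ex_hom_bound (V : finType) (E : rel V) :
  symmetric E -> irreflexive E -> clique_free r E ->
  khom_bound g E ((A * ex)%:R / (n ^_ h)%:R : R).
Proof.
move=> Es Ei Ecf x x0; set s := \sum_a x a.
have s0 : 0 <= s by apply: sumr_ge0.
set t := \sum_phi _.
(* Each of the [n ^_ h] injections [psi] contributes [s ^+ (n - h) * t] to the weighted sum over
   blow-ups, and no blow-up has more than [ex] copies. *)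
have main : (n ^_ h)%:R * (s ^+ (n - h) * t) <= (A * ex)%:R * s ^+ n.
  have -> : (n ^_ h)%:R * (s ^+ (n - h) * t) =
    \sum_(f : {ffun 'I_n -> V}) (\prod_a x (f a)) * (A * Ncopies H (blowup E f))%:R.
    under eq_bigr => f _.
      rewrite -card_copies -sum1dep_card natr_sum mulr_sumr big_mkcond /=.
      under eq_bigr => psi _.
        rewrite imset_cmp_graph (_ : (if _ then _ else _) = (injectiveb psi)%:R *
          ((\prod_a x (f a)) * (khom g E [ffun i => f (psi i)])%:R)); last first.
          have -> : khom g (adj (blowup E f)) psi = khom g E [ffun i => f (psi i)].
            by apply/khomP/khomP => Hh i j gij; have := Hh i j gij; rewrite !ffunE adj_blowup.
          by case: (injectiveb psi); case: (khom _ _ _); rewrite /= ?mulr1 ?mulr0 ?mul1r ?mul0r.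
        over.
      over.
    rewrite exchange_big /=; under eq_bigr do rewrite -mulr_sumr.
    rewrite -[h in n ^_ h]card_ord -[n in n ^_ _]card_ord -card_inj_ffuns -sum1_card natr_sum.
    rewrite mulr_suml big_mkcond; apply: eq_bigr => psi _; rewrite inE.
    have [/injectiveP ipsi|_] := boolP (injectiveb psi); last by rewrite mul0r.
    by rewrite (sum_marginal x (fun phi => (khom g E phi)%:R) ipsi).
  have -> : s ^+ n = \sum_(f : {ffun 'I_n -> V}) \prod_a x (f a).
    by rewrite -[n in LHS]card_ord -prodr_const bigA_distr_bigA.
  rewrite mulr_sumr; apply: ler_sum => f _; rewrite mulrC ler_wpM2r ?prodr_ge0 //.
  rewrite ler_nat leq_mul2l; apply/orP; right.
  rewrite /ex_gen (leq_bigmax_cond (blowup E f)) // blowup_graph //=.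
  apply/Ffree_clique; first exact: blowup_graph.
  move=> phi; apply: contra (Ecf (fun i => f (phi i))) => /forallP Hh.
  apply/forallP => i; apply/forallP => j; apply/implyP => ij.
  by have /forallP/(_ j)/implyP/(_ ij) := Hh i; rewrite adj_blowup.
have [sz|sn] := eqVneq s 0.
  have xz a : x a = 0.
    apply/eqP; have := sz; rewrite /s => /eqP; rewrite psumr_eq0 // => /allP/(_ a).
    by rewrite mem_index_enum => /(_ isT).
  rewrite sz expr0n gtn_eqF // mulr0 /t big1 // => phi _.
  by rewrite (bigD1 (Ordinal h0)) //= xz mul0r mulr0.
have sp : 0 < s by rewrite lt_def sn.
rewrite mulrAC ler_pdivlMr ?ffact_pos // mulrC.
rewrite -(ler_pM2l (exprn_gt0 (n - h) sp)).
have -> : s ^+ (n - h) * ((A * ex)%:R * s ^+ h) = (A * ex)%:R * s ^+ n.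
  by rewrite mulrCA -exprD subnK.
by rewrite mulrCA.
Qed.

(** [ex_hom_bound] is applied to [K_k] with unit weights, where [g] itself is a homomorphism;
    [k <= r] makes [K_k] free of [K_{r+1}]. *)
Lemma ex_density_ge : (k <= r)%N ->
  (k%:R ^+ h)^-1 <= (A * ex)%:R / (n ^_ h)%:R :> R.
Proof.
move=> kr.
have k0 : 0 < k%:R :> R.
  by rewrite ltr0n; apply: leq_ltn_trans (ltn_ord (g (Ordinal h0))).
have cf : clique_free r (fun a b : 'I_k => a != b).
  move=> phi; apply/negP => /forallP Hh.
  have iphi : injective phi.
    move=> i j eij; apply/eqP/negPn/negP => ij.
    by have /forallP/(_ j)/implyP/(_ ij) := Hh i; rewrite eij eqxx.
  have := leq_card phi iphi; rewrite !card_ord => rk.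
  by have := leq_trans rk kr; rewrite ltnn.
have Ks : symmetric (fun a b : 'I_k => a != b) by move=> a b; rewrite eq_sym.
have Ki : irreflexive (fun a b : 'I_k => a != b) by move=> a; rewrite eqxx.
have := ex_hom_bound Ks Ki cf (fun=> ler01).
rewrite sumr_const card_ord => bd.
rewrite -[leLHS]mul1r ler_pdivrMr ?exprn_gt0 //; apply: le_trans bd.
rewrite (bigD1 (finfun g)) //= big1_eq mulr1 -[leLHS]addr0 lerD //.
  suff -> : khom g (fun a b => a != b) (finfun g) by [].
  by apply/khomP => i j; rewrite !ffunE.
by apply: sumr_ge0 => phi _; rewrite mulr1.
Qed.

End ExtremalBound.

(** * From homomorphisms to copies and edit distance *)

(** Power and falling factorial differ by a term of lower order; the form avoids subtraction and the
    exponent [h - 1]. *)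
Lemma expn_ffact_gap h n : (n * n ^ h <= n * n ^_ h + h ^ 2 * n ^ h)%N.
Proof.
elim: h => [|h IH]; first by rewrite !expn0 muln1 leq_addr.
rewrite ffactnSr expnS.
have [nh|hn] := leqP n h.
  have -> : (n - h = 0)%N by apply/eqP; rewrite subn_eq0.
  rewrite !muln0 add0n leq_mul2r; apply/orP; right; nia.
have := leq_mul IH (leqnn (n - h)); rewrite mulnDl => H.
have {2}-> : (n = (n - h) + h)%N by rewrite subnK // ltnW.
nia.
Qed.

(** The identity labelling, the default value of the minimum in [edit_dist], already suffices: each
    edge of the symmetric difference yields an ordered pair on which the adjacencies differ. *)
Lemma edit_dist_adj (R : realFieldType) n r (G : {set {set 'I_n}}) (T : 'I_n -> 'I_r) :
  is_graph G -> (edit_dist G (cmp_graph T))%:R <=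
    \sum_a \sum_b (adj G a b != multipartite T a b)%:R :> R.
Proof.
move=> gG; set K := cmp_graph T.
have adjK a b : adj K a b = multipartite T a b.
  by apply: (adj_blowup (E := fun x y => x != y)) => x y; rewrite eq_sym.
have gK : is_graph K by apply: (blowup_graph (E := fun x y => x != y)) => x; rewrite eqxx.
apply: (@le_trans _ _ (#|(G :\: K) :|: (K :\: G)|)%:R).
  rewrite ler_nat /edit_dist; elim/big_rec: _ => // s y _ H.
  by apply: leq_trans (geq_minr _ _) H.
pose S := [set p : 'I_n * 'I_n | adj G p.1 p.2 != multipartite T p.1 p.2].
have -> : \sum_a \sum_b (adj G a b != multipartite T a b)%:R = #|S|%:R :> R.
  rewrite pair_bigA -sum1dep_card natr_sum [RHS]big_mkcond; apply: eq_bigr => p _ /=.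
  by case: (_ != _).
rewrite ler_nat; apply: leq_trans (leq_imset_card (fun p => [set p.1; p.2]) (mem S)).
apply: subset_leq_card; apply/subsetP => e eGK.
have /cards2P[a [b [_ eE]]] : #|e| == 2.
  move: eGK; rewrite !inE => /orP[] /andP[_ eG]; first by have /forall_inP := gG; apply.
  by have /forall_inP := gK; apply.
apply/imsetP; exists (a, b); rewrite //= inE /= -adjK /adj -eE.
by move: eGK; rewrite !inE; case: (e \in G); case: (e \in K).
Qed.

Theorem theorem1p1 (R : realType) (k r h : nat) (H : {set {set 'I_h}}) :
  (2 <= k)%N -> (k <= r)%N -> is_complete_kpartite k H ->
  forall eps : R, 0 < eps ->
  exists delta : R, 0 < delta /\
  exists n0 : nat, forall n : nat, (n0 <= n)%N ->
  forall G : {set {set 'I_n}},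
    is_graph G -> Ffree (Kgraph r.+1) G ->
    (ex_gen n H (Kgraph r.+1))%:R - delta * n%:R ^+ h <= (Ncopies H G)%:R ->
    exists T : 'I_n -> 'I_r,
      (edit_dist G (cmp_graph T))%:R <= eps * n%:R ^+ 2.
Proof.
move=> k2 kr [g [gs ->]] eps eps0.
case: r kr => [|r] kr; first by move: k2; rewrite leqNgt ltnS (leq_trans kr).
have [i0 _] := gs (Ordinal (ltnW k2)).
have h0 : (0 < h)%N := leq_ltn_trans (leq0n _) (ltn_ord i0).
have k0 : 0 < k%:R :> R by rewrite ltr0n (ltn_trans _ k2).
have tau0 : 0 < (k%:R ^+ h)^-1 :> R by rewrite invr_gt0 exprn_gt0.
have [d d0 stab] := hom_stability h r k2 tau0 eps0.
pose A : R := #|automorphisms (cmp_graph g)|%:R.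
have A0 : 0 < A by rewrite ltr0n automorphisms_gt0.
(* The factor [A] turns copies into injective homomorphisms. Half of the loss [d] allowed by [stab]
   is spent here, half on replacing [n ^_ h] by [n ^ h]. *)
exists (d / 2 / A); split; first by rewrite !divr_gt0.
(* Beyond the second bound, [h^2 n^(h-1)] is at most [d / 2] times [n^h]. *)
exists (maxn h (Num.bound (2 * h%:R ^+ 2 / d))) => n; rewrite geq_max => /andP[hn nn0].
move=> G gG Gfree near.
have n0 : (0 < n)%N := leq_trans h0 hn.
have np : 0 < n%:R :> R by rewrite ltr0n.
have X0 : 0 < n%:R ^+ h :> R by rewrite exprn_gt0.
have ff0 := ffact_pos R hn.
pose Lam : R := (#|automorphisms (cmp_graph g)| * ex_gen n (cmp_graph g) (Kgraph r.+2))%:R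
  / (n ^_ h)%:R.
have cf : clique_free r.+1 (adj G) by apply/Ffree_clique.
have bd : khom_bound g (adj G) Lam.
  by apply: ex_hom_bound => //; [apply: adjC | apply: adj_irr].
have tauL : (k%:R ^+ h)^-1 <= Lam by apply: ex_density_ge.
have Lam1 : Lam <= 1 by rewrite ler_pdivrMr // mul1r ler_nat ex_le_ffact.
have [||T errT] := stab g 'I_n (adj G) Lam gs _ (@adjC _ G) (adj_irr gG) cf bd tauL _.
- by rewrite card_ord.
- rewrite card_ord; apply: le_trans (copies_le_hom R g G).
  have gap : n%:R ^+ h <= (n ^_ h)%:R + d / 2 * n%:R ^+ h :> R.
    rewrite -(ler_pM2l np) mulrDr.
    have := expn_ffact_gap h n; rewrite -(ler_nat R) natrD !natrM !natrX => /le_trans; apply.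
    rewrite lerD2l mulrA ler_wpM2r ?(ltW X0) //.
    have : 2 * h%:R ^+ 2 / d < n%:R.
      apply: lt_le_trans (archi_boundP _) _; last by rewrite ler_nat.
      by rewrite !mulr_ge0 ?sqr_ge0 // invr_ge0 ltW.
    by rewrite ltr_pdivrMr //; lra.
  have LamE : A * (ex_gen n (cmp_graph g) (Kgraph r.+2))%:R = Lam * (n ^_ h)%:R.
    by rewrite /Lam natrM mulfVK // gt_eqF.
  have := ler_wpM2l (ltW A0) near; rewrite mulrBr LamE natrM => {}near.
  apply: le_trans near.
  have -> : A * (d / 2 / A * n%:R ^+ h) = d / 2 * n%:R ^+ h by field; rewrite gt_eqF.
  have L0 : 0 <= Lam by apply: le_trans tauL; rewrite ltW.
  have := ler_wpM2l L0 gap; rewrite mulrDr.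
  have : Lam * (d / 2 * n%:R ^+ h) <= 1 * (d / 2 * n%:R ^+ h).
    by rewrite ler_wpM2r // mulr_ge0 ?(ltW X0) // divr_ge0 // ltW.
  lra.
exists T; apply: le_trans (edit_dist_adj R T gG) _.
by rewrite card_ord in errT.
Qed.
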